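(* Let $\mathscr{H},\mathscr{K}$ be Hilbert spaces and let $0<m<M$. Let $A_1,\ldots,A_n\in\mathbb{B}(\mathscr{H})$ be positive invertible operators with $\sigma(A_i)\subseteq[m,M]$, and let $\Phi_1,\ldots,\Phi_n:\mathbb{B}(\mathscr{H})\to\mathbb{B}(\mathscr{K})$ be positive linear maps with $\sum_{i=1}^n\Phi_i(\mathbf{1}_{\mathscr{H}})=\mathbf{1}_{\mathscr{K}}$. Let $\varphi,\psi:[m,M]\to\mathbb{R}$ be two continuous strictly monotonic functions. If $\psi\circ\varphi^{-1}$ is a log-convex function on $\varphi([m,M])$ (in particular, positive) and $\psi^{-1}$ is operator increasing, then $$\widetilde{M}_\varphi\le\psi^{-1}\left\{[\psi(m)]^{\frac{\sum_{i=1}^n\Phi_i(\varphi(A_i))-\varphi(m)\mathbf{1}_{\mathscr{K}}}{\varphi(M)-\varphi(m)}}\,[\psi(M)]^{\frac{\varphi(M)\mathbf{1}_{\mathscr{K}}-\sum_{i=1}^n\Phi_i(\varphi(A_i))}{\varphi(M)-\varphi(m)}}\right\}\le\widetilde{M}_\psi,$$ where $\widetilde{M}_\varphi$ and $\widetilde{M}_\psi$ are the operator quasi-arithmetic means of Mercer's type of $(A_1,\ldots,A_n)$ with respect to $(\Phi_1,\ldots,\Phi_n)$ (defined in the context).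
   Context: $\mathbb{B}(\mathscr{H})$ is the $C^*$-algebra of all bounded linear operators on $\mathscr{H}$, $\mathbf{1}_{\mathscr{H}}$ is the identity operator and $\sigma(A)$ the spectrum of $A$. $A\ge 0$ means $\langle Ax,x\rangle\ge 0$ for all $x$; for self-adjoint $A,B$, $A\le B$ means $B-A\ge 0$. A linear map $\Phi:\mathbb{B}(\mathscr{H})\to\mathbb{B}(\mathscr{K})$ is positive if $\Phi(A)\ge 0$ whenever $A\ge 0$. Functions of self-adjoint operators are defined by the continuous functional calculus; for a scalar $c>0$ and a self-adjoint operator $T$, $c^T:=\exp((\log c)\,T)$. A positive function $f$ on an interval is log-convex if $\log f$ is convex. For a continuous strictly monotonic $\varphi:[m,M]\to\mathbb{R}$, the operator quasi-arithmetic mean of Mercer's type is $$\widetilde{M}_\varphi:=\varphi^{-1}\left((\varphi(M)+\varphi(m))\mathbf{1}_{\mathscr{K}}-\sum_{i=1}^n\Phi_i(\varphi(A_i))\right),$$ where $\varphi^{-1}:\varphi([m,M])\to[m,M]$ is the inverse function. A continuous real function $g$ on a compact interval $I$ is operator increasing (operator monotone) if $g(A)\le g(B)$ whenever $A,B$ are self-adjoint operators on a Hilbert space with spectra in $I$ and $A\le B$. The condition that $\psi^{-1}$ is operator increasing refers to the interval $I=\psi([m,M])$. *)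

(* Defs.v *)
From HB Require Import structures.
From mathcomp Require Import all_boot all_order all_algebra.
From mathcomp Require Import all_classical all_reals all_analysis.
From mathcomp Require Import complex.

Set Implicit Arguments.
Unset Strict Implicit.
Unset Printing Implicit Defensive.

Import Order.TTheory GRing.Theory Num.Theory.
Import numFieldNormedType.Exports.

Local Open Scope classical_set_scope.
Local Open Scope ring_scope.
Local Open Scope complex_scope.

(* Complex Hilbert spaces. The form is linear in its first argument and       *)
(* conjugate-linear in the second one. No nontriviality or separability is    *)
(* required.                                                                  *)
HB.mixin Record CompleteNormedModule_isHilbert (R : realType) T
    of CompleteNormedModule R[i] T := {
  inner : {dot T for (@Num.conj R[i])} ;
  inner_norm : forall x : T, inner x x = `|x| ^+ 2
}.

#[short(type="hilbertType")]
HB.structure Definition Hilbert (R : realType) :=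
  {T of CompleteNormedModule_isHilbert R T & CompleteNormedModule R[i] T}.

Section BoundedOperators.
Context {R : realType} (H : hilbertType R).

Definition bounded_linear_op : {pred H -> H} :=
  mem [set f : H -> H | linear f /\
    exists c : R, forall x, `|f x| <= c%:C * `|x|].

Record bounded_op := BoundedOp {
  bounded_op_fun :> H -> H ;
  _ : bounded_op_fun \in bounded_linear_op }.

HB.instance Definition _ := [isSub for bounded_op_fun].
HB.instance Definition _ := [Choice of bounded_op by <:].

Lemma bounded_linear_opP (f : H -> H) :
  reflect (linear f /\ exists c : R, forall x, `|f x| <= c%:C * `|x|)
          (f \in bounded_linear_op).
Proof. by apply: (iffP idP); rewrite in_setE. Qed.

Lemma bounded_linear_op_submod : submod_closed bounded_linear_op.
Proof.
split=> [|a f g /bounded_linear_opP[lf [c fc]] /bounded_linear_opP[lg [d gd]]].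
  apply/bounded_linear_opP; split=> [a x y|]; first by rewrite scaler0 addr0.
  by exists 0 => x; rewrite rmorph0 mul0r normr0.
apply/bounded_linear_opP; split=> [b x y|].
  by rewrite /= !fctE lf lg !scalerDr !scalerA (mulrC b a) addrACA.
exists (complex.Re `|a| * c + d) => x.
rewrite rmorphD rmorphM /= mulrDl (le_trans (ler_normD _ _))// lerD//.
rewrite normrZ -[X in X * _ <= _]RRe_real ?normr_real// -mulrA ler_wpM2l//.
by rewrite RRe_real ?normr_real.
Qed.

HB.instance Definition _ := GRing.isSubmodClosed.Build R[i] (H -> H)
  bounded_linear_op bounded_linear_op_submod.
HB.instance Definition _ := [SubChoice_isSubLmodule of bounded_op by <:].


Lemma bounded_linear_op_id : idfun \in bounded_linear_op.
Proof.
apply/bounded_linear_opP; split=> [a x y //|].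
by exists 1 => x; rewrite mul1r.
Qed.

Lemma bounded_linear_op_comp (f g : H -> H) :
  f \in bounded_linear_op -> g \in bounded_linear_op ->
  f \o g \in bounded_linear_op.
Proof.
move=> /bounded_linear_opP[lf [c fc]] /bounded_linear_opP[lg [d gd]].
apply/bounded_linear_opP; split=> [a x y|]; first by rewrite /= lg lf.
exists (`|c| * d) => x; rewrite rmorphM -mulrA /= (le_trans (fc _))//.
rewrite (@le_trans _ _ (`|c|%:C * `|g x|))//.
  by rewrite ler_wpM2r// lecR ler_norm.
by rewrite ler_wpM2l// lecR.
Qed.

Definition one_op : bounded_op := BoundedOp bounded_linear_op_id.
Definition mul_op (A B : bounded_op) : bounded_op :=
  BoundedOp (bounded_linear_op_comp (valP A) (valP B)).

Fact mul_opA : associative mul_op. Proof. by move=> A B C; apply: val_inj. Qed.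
Fact mul_op1 : left_id one_op mul_op. Proof. by move=> A; apply: val_inj. Qed.
Fact mul1_op : right_id one_op mul_op. Proof. by move=> A; apply: val_inj. Qed.
Fact mul_opDl : left_distributive mul_op +%R.
Proof. by move=> A B C; apply: val_inj. Qed.
Fact mul_opDr : right_distributive mul_op +%R.
Proof.
move=> A B C; apply: val_inj; apply/funext => x /=.
have [lA _] := bounded_linear_opP _ (valP A).
by rewrite !fctE /= -[X in val A (X + _)]scale1r lA scale1r.
Qed.

(* Composition of operators; the ring may be trivial since H may be. *)
HB.instance Definition _ := GRing.Zmodule_isPzRing.Build bounded_op
  mul_opA mul_op1 mul1_op mul_opDl mul_opDr.

End BoundedOperators.

Notation "''B' ( H )" := (bounded_op H)
  (at level 8, format "''B' ( H )") : type_scope.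

Section OperatorTheory.
Context {R : realType} {H : hilbertType R}.
Implicit Types (A B : 'B(H)) (f : R -> R).

Definition self_adjoint A := forall x y : H, inner (A x) y = inner x (A y).

(* In the order of R[i], 0 <= z means that z is real and nonnegative. *)
Definition positive_op A := forall x : H, 0 <= inner (A x) x.

Definition invertible_op A := exists B, A * B = 1 /\ B * A = 1.

(* Used for self-adjoint A and B only. *)
Definition le_op A B := positive_op (B - A).

Definition spectrum A : set R[i] :=
  [set z | ~ invertible_op (A - z *: (1 : 'B(H)))].

Definition spectrum_in A (I : set R) :=
  spectrum A `<=` [set t%:C | t in I].

Definition op_norm A : R :=
  sup [set complex.Re `|A x| | x in [set x : H | `|x| <= 1]].

Definition poly_op (p : {poly R}) A : 'B(H) :=
  \sum_(i < size p) (p`_i)%:C *: A ^+ i.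

(* Continuous functional calculus of a self-adjoint A, whose spectrum is real: *)
(* f(A) is the limit in operator norm of p_n(A), for real polynomials p_n      *)
(* converging to f uniformly on the spectrum of A.                             *)
Definition is_fun_calc f A B :=
  exists p : nat -> {poly R},
    {uniform [set t : R | spectrum A t%:C],
      (fun n => horner (p n) : R -> R) @ \oo --> f} /\
    op_norm (poly_op (p n) A - B) @[n --> \oo] --> (0 : R).

(* Such a limit exists and is unique when A is self-adjoint and f is           *)
(* continuous on its spectrum; otherwise 0 is a placeholder.                   *)
Definition fun_calc f A : 'B(H) := xget 0 [set B | is_fun_calc f A B].

Definition pow_op (c : R) A : 'B(H) := fun_calc expR ((ln c)%:C *: A).

End OperatorTheory.

Definition positive_map (R : realType) (H K : hilbertType R)
    (Phi : 'B(H) -> 'B(K)) :=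
  forall A, positive_op A -> positive_op (Phi A).

Section RealFunctions.
Context {R : realType}.

Definition strictly_monotonic (I : set R) (f : R -> R) :=
  {in I &, forall x y, x < y -> f x < f y} \/
  {in I &, forall x y, x < y -> f y < f x}.

Definition log_convex (I : set R) (f : R -> R) :=
  (forall x, I x -> 0 < f x) /\
  convex_function (I : set R^o) (fun x : R^o => ln (f x) : R^o).

(* g is meant to be continuous on I, and I to be a compact interval; this holds *)
(* for the inverse of a continuous strictly monotonic function on a segment.    *)
Definition operator_increasing (I : set R) (g : R -> R) :=
  forall (H : hilbertType R) (A B : 'B(H)),
    self_adjoint A -> self_adjoint B ->
    spectrum_in A I -> spectrum_in B I ->
    le_op A B -> le_op (fun_calc g A) (fun_calc g B).

End RealFunctions.

Section MercerMean.
Context {R : realType} {H K : hilbertType R} {n : nat}.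
Variables (m M : R) (A : 'I_n -> 'B(H)) (Phi : 'I_n -> 'B(H) -> 'B(K)).

Definition sum_Phi (phi : R -> R) : 'B(K) :=
  \sum_(i < n) Phi i (fun_calc phi (A i)).

Definition mercer_mean (phi : R -> R) : 'B(K) :=
  fun_calc (pinv `[m, M] phi) ((phi M + phi m)%:C *: (1 : 'B(K)) - sum_Phi phi).

End MercerMean.

(* Main.v *)
(* Put T = phi(M) + phi(m) - S, g = psi o phi^-1 and, for t between phi(m) and
   phi(M), w(t) = (phi(M) - t) / (phi(M) - phi(m)), so that
   t = w(t) phi(m) + (1 - w(t)) phi(M). Log-convexity of g and the inequality
   between weighted geometric and arithmetic means give
     g(t) <= h(t) := psi(m)^w(t) psi(M)^(1 - w(t))
          <= w(t) psi(m) + (1 - w(t)) psi(M).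
   Applied at T, the first inequality and the monotonicity of psi^-1 give the
   left half. Applied at T and at the phi(A_i), the two inequalities bound h(T)
   and the sum of the Phi_i(psi(A_i)) by affine functions of S which add up to
   psi(m) + psi(M), and this is the right half.

   The functional calculus rests on two facts on a self-adjoint A: the infimum
   of its numerical range is in its spectrum, so that a real polynomial that is
   nonnegative on the spectrum is nonnegative at A; and a coercive A is
   invertible by a Neumann series. Approximation by polynomials on a segment is
   Bernstein's proof of the Weierstrass theorem. *)

Require Import Defs.
From HB Require Import structures.
From mathcomp Require Import all_boot all_order all_algebra.
From mathcomp Require Import all_classical all_reals all_analysis.
From mathcomp Require Import complex.
From mathcomp Require Import ring lra.

Set Implicit Arguments.
Unset Strict Implicit.
Unset Printing Implicit Defensive.

Import Order.TTheory GRing.Theory Num.Theory.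
Import numFieldNormedType.Exports.

Local Open Scope classical_set_scope.
Local Open Scope ring_scope.
Local Open Scope complex_scope.

(** * Hilbert spaces and bounded operators *)

Section RealStructure.
Context {R : realType} {H : hilbertType R}.
Implicit Types (x y z : H) (a b : R).

(* The norm of [H] takes its values in [R[i]]. *)
Definition nm x : R := complex.Re `|x|.
(** A real inner product with the same norm. Estimates on it stay in the ordered field [R], where
    [lra] and [nra] apply. *)
Definition ri x y : R := complex.Re (inner x y).

Lemma nmE x : `|x| = (nm x)%:C.
Proof. by rewrite /nm RRe_real// normr_real. Qed.

Lemma nm_ge0 x : 0 <= nm x.
Proof. by rewrite -ler0c -nmE. Qed.

Lemma nmD x y : nm (x + y) <= nm x + nm y.
Proof. by rewrite -lecR rmorphD/= -!nmE ler_normD. Qed.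

Lemma nmN x : nm (- x) = nm x.
Proof. by rewrite /nm normrN. Qed.

Lemma nm_eq0 x : nm x = 0 -> x = 0.
Proof. by move=> x0; apply/eqP; rewrite -normr_eq0 nmE x0. Qed.

Lemma nm0 : nm 0 = 0.
Proof. by rewrite /nm normr0. Qed.

Lemma nmB x y z : nm (x - z) <= nm (x - y) + nm (y - z).
Proof. by rewrite (le_trans _ (nmD _ _))// addrA subrK. Qed.

Lemma nmZ (c : R[i]) x : nm (c *: x) = complex.Re `|c| * nm x.
Proof.
by rewrite {1}/nm normrZ nmE -[`|c|]RRe_real ?normr_real//= mul0r subr0.
Qed.

Lemma nmZR a x : nm (a%:C *: x) = `|a| * nm x.
Proof. by rewrite nmZ normc_def/= expr0n addr0 sqrtr_sqr. Qed.

Lemma innerC x y : inner x y = (inner y x)^*%C.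
Proof. by rewrite hermC expr0 mul1r. Qed.

Lemma innerZl (c : R[i]) x y : inner (c *: x) y = c * inner x y.
Proof. by rewrite linearZl_LR. Qed.

Lemma innerZr (c : R[i]) x y : inner x (c *: y) = c^*%C * inner x y.
Proof. by rewrite linearZr_LR. Qed.

Lemma riC x y : ri x y = ri y x.
Proof. by rewrite /ri innerC; case: (inner y x). Qed.

Lemma ReD (u v : R[i]) : complex.Re (u + v) = complex.Re u + complex.Re v.
Proof. by case: u v => [? ?] []. Qed.

Lemma ReN (u : R[i]) : complex.Re (- u) = - complex.Re u.
Proof. by case: u. Qed.

Lemma riDl x y z : ri (x + y) z = ri x z + ri y z.
Proof.
by rewrite /ri linearDl ReD.
Qed.

Lemma riNl x z : ri (- x) z = - ri x z.
Proof. by rewrite /ri linearNl ReN. Qed.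

Lemma riZl a x z : ri (a%:C *: x) z = a * ri x z.
Proof.
by rewrite /ri innerZl; case: (inner x z) => u v /=; rewrite mul0r subr0.
Qed.

Lemma riDr x y z : ri z (x + y) = ri z x + ri z y.
Proof. by rewrite riC riDl ![ri _ z]riC. Qed.

Lemma riNr x z : ri z (- x) = - ri z x.
Proof. by rewrite riC riNl riC. Qed.

Lemma riZr a x z : ri z (a%:C *: x) = a * ri z x.
Proof. by rewrite riC riZl riC. Qed.

Definition riE := (riDl, riNl, riZl, riDr, riNr, riZr).

Lemma innerxx x : inner x x = (nm x ^+ 2)%:C.
Proof. by rewrite inner_norm nmE rmorphXn. Qed.

Lemma rixx x : ri x x = nm x ^+ 2.
Proof. by rewrite /ri innerxx. Qed.

Lemma ri_CauchySchwarz x y : `|ri x y| <= nm x * nm y.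
Proof.
have [x0|x0] := eqVneq (nm x) 0.
  by rewrite x0 mul0r (nm_eq0 x0) /ri linear0l normr0.
have [y0|y0] := eqVneq (nm y) 0.
  by rewrite y0 mulr0 (nm_eq0 y0) /ri linear0r normr0.
have {}x0 : 0 < nm x by rewrite lt_neqAle eq_sym x0 nm_ge0.
have {}y0 : 0 < nm y by rewrite lt_neqAle eq_sym y0 nm_ge0.
have xy0 := mulr_gt0 x0 y0.
rewrite ler_norml; apply/andP; split.
  (* The squared norm equals [2 * nm x * nm y * (nm x * nm y + ri x y)], whose first factors are
     positive; the other sign is symmetric. *)
  have := sqr_ge0 (nm ((nm y)%:C *: x + (nm x)%:C *: y)).
  by rewrite -rixx !riE !rixx (riC y x) => h; nra.
have := sqr_ge0 (nm ((nm y)%:C *: x - (nm x)%:C *: y)).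
by rewrite -rixx !riE !rixx (riC y x) => h; nra.
Qed.

Lemma sup_geometric (u : nat -> H) (C q : R) : 0 <= C -> 0 <= q -> q < 1 ->
  (forall k, nm (u k.+1 - u k) <= C * q ^+ k) ->
  forall n k, nm (u (n + k)%N - u n) <= C * q ^+ n / (1 - q).
Proof.
move=> C0 q0 q1 hu n k.
have q1' : 0 < 1 - q by rewrite subr_gt0.
(* The exact partial sum of the geometric series is what the induction on [k] carries; the stated
   bound alone is not inductive. *)
suff h : nm (u (n + k)%N - u n) <= C * q ^+ n * (1 - q ^+ k) / (1 - q).
  apply: le_trans h _; rewrite ler_wpM2r ?invr_ge0 ?(ltW q1')//.
  rewrite -[leRHS]mulr1 ler_wpM2l ?mulr_ge0 ?exprn_ge0//.
  by rewrite gerBl exprn_ge0.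
elim: k => [|k ih]; first by rewrite addn0 subrr nm0 expr0 subrr mulr0 mul0r.
apply: le_trans (nmB _ (u (n + k)%N) _) _.
rewrite addnS; apply: le_trans (lerD (hu _) ih) _.
rewrite exprD exprS le_eqVlt; apply/orP; left; apply/eqP.
by field; rewrite gt_eqF.
Qed.

Lemma geometric_small (C q e : R) : 0 <= q -> q < 1 -> 0 < e ->
  exists n, C * q ^+ n <= e.
Proof.
move=> q0 q1 e0.
have := @cvg_geometric R C q; rewrite ger0_norm// => /(_ q1).
move=> /cvgrPdist_le/(_ _ e0) [N _ /(_ N (leqnn N))] /=.
by rewrite sub0r normrN => h; exists N; exact: le_trans (ler_norm _) h.
Qed.

(** Completeness with an explicit rate. The rate is what later makes pointwise limits of operators
    uniform. *)
Lemma geometric_cvg (u : nat -> H) (C q : R) : 0 <= C -> 0 <= q -> q < 1 ->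
  (forall k, nm (u k.+1 - u k) <= C * q ^+ k) ->
  exists l, forall n, nm (u n - l) <= C * q ^+ n / (1 - q).
Proof.
move=> C0 q0 q1 hu; have hs := sup_geometric C0 q0 q1 hu.
have q1' : 0 < 1 - q by rewrite subr_gt0.
have cu : cvgn u.
  apply/cauchy_cvgP/cauchy_ballP => e e0; near_simpl.
  have eR : e = (complex.Re e)%:C by rewrite RRe_real// gtr0_real.
  have e0' : 0 < complex.Re e by rewrite -ltcR -eR.
  have [N hN] := @geometric_small (C / (1 - q)) q (complex.Re e / 3) q0 q1 ltac:(by lra).
  have hN' k : nm (u (N + k)%N - u N) <= complex.Re e / 3.
    by apply: le_trans (hs _ _) _; rewrite mulrAC.
  exists ([set n | (N <= n)%N], [set n | (N <= n)%N]); first by split; exists N.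
  move=> [n m] /= [Nn Nm]; rewrite -ball_normE /= nmE eR ltcR.
  apply: le_lt_trans (nmB _ (u N) _) _.
  have := hN' (n - N)%N; have := hN' (m - N)%N; rewrite !subnKC// => h1 h2.
  by rewrite -[u N - _]opprB nmN; lra.
exists (limn u) => n; apply/ler_addgt0Pr => e e0.
have /cvgrPdist_le /(_ e%:C) := cu; rewrite ltcR => /(_ e0) [N _ hN].
have := hN (n + N)%N (leq_addl _ _); rewrite /= nmE lecR => h.
apply: le_trans (nmB _ (u (n + N)%N) _) _.
apply: lerD; first by rewrite -nmN opprB.
by rewrite -nmN opprB.
Unshelve. all: by end_near.
Qed.

End RealStructure.

(** * Operator bounds, completeness and the Neumann series *)

Section Operators.
Context {R : realType} {H : hilbertType R}.
Implicit Types (A B C D : 'B(H)) (x y z : H) (a b c : R).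

Lemma opD A B x : (A + B) x = A x + B x. Proof. by []. Qed.
Lemma opN A x : (- A) x = - A x. Proof. by []. Qed.
Lemma opZ (k : R[i]) A x : (k *: A) x = k *: A x. Proof. by []. Qed.
Lemma opM A B x : (A * B) x = A (B x). Proof. by []. Qed.
Lemma op1 x : (1 : 'B(H)) x = x. Proof. by []. Qed.
Lemma op0 x : (0 : 'B(H)) x = 0. Proof. by []. Qed.
Definition opE := (opD, opN, opZ, opM, op1, op0).

Lemma opP A B : (forall x, A x = B x) -> A = B.
Proof. by move=> AB; apply: val_inj; apply/funext. Qed.

Lemma op_linear A : linear A.
Proof. by have [] := bounded_linear_opP _ (valP A). Qed.

Lemma op_vD A x y : A (x + y) = A x + A y.
Proof. by have := op_linear A 1 x y; rewrite !scale1r. Qed.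

Lemma op_v0 A : A 0 = 0.
Proof.
have := op_linear A 1 0 0; rewrite scaler0 addr0 scale1r => /eqP.
by rewrite eq_sym -subr_eq0 addrK => /eqP.
Qed.

Lemma op_vZ A (k : R[i]) x : A (k *: x) = k *: A x.
Proof. by have := op_linear A k x 0; rewrite op_v0 !addr0. Qed.

Lemma op_vN A x : A (- x) = - A x.
Proof. by rewrite -scaleN1r op_vZ scaleN1r. Qed.

Definition op_vE := (op_vD, op_vN, op_vZ).

Lemma op_mulZr (k : R[i]) A B : A * (k *: B) = k *: (A * B).
Proof. by apply: opP => x; rewrite !opE op_vE. Qed.

Lemma op_mulZl (k : R[i]) A B : (k *: A) * B = k *: (A * B).
Proof. exact: opP. Qed.

(** Stands in for [op_norm A <= c], so that estimates involve no supremum; [bnd_op_norm] and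
    [op_norm_le] relate the two. *)
Definition bnd A c := forall x, nm (A x) <= c * nm x.

Lemma bnd_ex A : exists2 c : R, 0 < c & bnd A c.
Proof.
have [_ [c hc]] := bounded_linear_opP _ (valP A).
exists (`|c| + 1) => [|x]; first by rewrite ltr_wpDl.
have := hc x; rewrite !nmE -rmorphM /= lecR => h; apply: le_trans h _.
by rewrite ler_wpM2r ?nm_ge0// ler_wpDr// ler_norm.
Qed.

Lemma bnd_le A a b : bnd A a -> a <= b -> bnd A b.
Proof. by move=> h ab x; apply: le_trans (h x) _; rewrite ler_wpM2r ?nm_ge0. Qed.

Lemma bndD A B a b : bnd A a -> bnd B b -> bnd (A + B) (a + b).
Proof.
move=> hA hB x; rewrite opE mulrDl; apply: le_trans (nmD _ _) _.
by rewrite lerD.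
Qed.

Lemma bndN A a : bnd A a -> bnd (- A) a.
Proof. by move=> hA x; rewrite opE nmN. Qed.

Lemma bndM A B a b : 0 <= a -> bnd A a -> bnd B b -> bnd (A * B) (a * b).
Proof.
move=> a0 hA hB x; rewrite opE -mulrA; apply: le_trans (hA _) _.
by rewrite ler_wpM2l.
Qed.

Lemma bndZ A a c : bnd A a -> bnd (c%:C *: A) (`|c| * a).
Proof. by move=> hA x; rewrite opE nmZR -mulrA ler_wpM2l. Qed.

Lemma bnd1 : bnd (1 : 'B(H)) 1.
Proof. by move=> x; rewrite op1 mul1r. Qed.

Lemma bndX A a n : 0 <= a -> bnd A a -> bnd (A ^+ n) (a ^+ n).
Proof.
move=> a0 hA; elim: n => [|n ih]; first exact: bnd1.
by rewrite !exprS; apply: bndM.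
Qed.

Lemma bnd_small A : (forall e, 0 < e -> bnd A e) -> A = 0.
Proof.
move=> hA; apply: opP => x; apply: nm_eq0; apply/eqP.
rewrite eq_le nm_ge0 andbT; apply/ler_addgt0Pr => e e0; rewrite add0r.
have d0 : 0 < nm x + 1 by rewrite ltr_wpDl ?nm_ge0.
apply: le_trans (hA (e / (nm x + 1)) _ x) _; first by rewrite divr_gt0.
by rewrite -mulrA ler_piMr ?(ltW e0)// mulrC ler_pdivrMr// mul1r lerDl.
Qed.

(** The limit is taken pointwise. The rate is proportional to [nm x], so the convergence is in norm
    and the limit is again linear and bounded. *)
Lemma bnd_geometric_cvg (A : nat -> 'B(H)) (C q : R) : 0 <= C -> 0 <= q -> q < 1 ->
  (forall k, bnd (A k.+1 - A k) (C * q ^+ k)) ->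
  exists B, forall n, bnd (A n - B) (C * q ^+ n / (1 - q)).
Proof.
move=> C0 q0 q1 hA.
have h x : exists l, forall n,
    nm (A n x - l) <= C * q ^+ n / (1 - q) * nm x.
  have [|n|l hl] := @geometric_cvg _ _ (fun n => A n x) (C * nm x) q _ q0 q1.
  - by rewrite mulr_ge0 ?nm_ge0.
  - by have := hA n x; rewrite mulrAC !opE.
  - exists l => n; apply: le_trans (hl n) _.
    by rewrite [C * nm x * _]mulrAC [leLHS]mulrAC.
have /choice[B hB] := h.
have B_lin : linear B.
  move=> k x y; apply/eqP; rewrite -subr_eq0; apply/eqP; apply: nm_eq0.
  apply/eqP; rewrite eq_le nm_ge0 andbT.
  set K := complex.Re `|k| .
  set Z := nm (k *: x + y) + K * nm x + nm y.
  have K0 : 0 <= K by rewrite /K -ler0c RRe_real ?normr_real.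
  apply/ler_addgt0Pr => e e0; rewrite add0r.
  have [n hn] := @geometric_small _ (C / (1 - q) * Z) q e q0 q1 e0.
  apply: le_trans hn.
  (* Since [A n] is linear, the defect of linearity of [B] is a combination of three approximation
     errors; [Z] collects their sizes. *)
  have -> : B (k *: x + y) - (k *: B x + B y) =
     - (A n (k *: x + y) - B (k *: x + y)) + k *: (A n x - B x) + (A n y - B y).
    rewrite op_linear opprB scalerBr -addrA (addrACA (_ *: A n x)) -opprD.
    by rewrite addrA subrK.
  apply: le_trans (nmD _ _) _; apply: le_trans (lerD (nmD _ _) (lexx _)) _.
  rewrite nmN nmZ -/K.
  have h1 := hB (k *: x + y) n; have h2 := hB x n; have h3 := hB y n.
  have h2' := ler_wpM2l K0 h2.
  apply: le_trans (lerD (lerD h1 h2') h3) _; rewrite /Z.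
  by rewrite le_eqVlt; apply/orP; left; apply/eqP; ring.
have B_bnd : exists c : R, forall x, `|B x| <= c%:C * `|x|.
  have [c c0 hc] := bnd_ex (A 0%N).
  exists (c + C / (1 - q)) => x; rewrite !nmE -rmorphM /= lecR mulrDl.
  rewrite -[B x](subrK (A 0%N x)) addrC; apply: le_trans (nmD _ _) _.
  apply: lerD; first exact: hc.
  by rewrite -nmN opprB; apply: le_trans (hB x 0%N) _; rewrite expr0 mulr1.
have Bop : B \in @bounded_linear_op R H by apply/bounded_linear_opP.
by exists (BoundedOp Bop) => n x; rewrite !opE; exact: hB.
Qed.

(** The partial sums [A n] of the powers of [D] converge geometrically. Their products with [1 - D],
    on either side, telescope to [1 - D ^+ n], which tends to [1]. *)
Lemma neumann D (q : R) : 0 <= q -> q < 1 -> bnd D q -> invertible_op (1 - D).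
Proof.
move=> q0 q1 hD; pose A n := \sum_(i < n) D ^+ i.
have [|B hB] := @bnd_geometric_cvg A 1 q ler01 q0 q1.
  by move=> k; rewrite mul1r /A big_ord_recr/= addrAC subrr add0r; exact: bndX.
have hl n : (1 - D) * A n = 1 - D ^+ n.
  elim: n => [|n ih]; first by rewrite /A big_ord0 mulr0 expr0 subrr.
  rewrite /A big_ord_recr /= mulrDr ih mulrBl mul1r exprS.
  by rewrite addrA subrK.
have hr n : A n * (1 - D) = 1 - D ^+ n.
  elim: n => [|n ih]; first by rewrite /A big_ord0 mul0r expr0 subrr.
  rewrite /A big_ord_recr /= mulrDl ih mulrBr mulr1 exprSr.
  by rewrite addrA subrK.
have h1D : bnd (1 - D) (1 + q) by apply: bndD; [exact: bnd1|exact: bndN].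
have q1' : 0 < 1 - q by rewrite subr_gt0.
have q2 : 0 <= 1 + q by rewrite addr_ge0.
exists B; split; apply/eqP; rewrite -subr_eq0; apply/eqP; apply: bnd_small => e e0;
  have [n hn] := geometric_small ((1 + q) / (1 - q) + 1) q0 q1 e0.
- have -> : (1 - D) * B - 1 = - ((1 - D) * (A n - B)) - D ^+ n.
    by rewrite mulrBr hl [- (1 - _ - _)]opprB opprB -addrA addrAC subrr sub0r.
  apply: bnd_le (bndD (bndN (bndM q2 h1D (hB n))) (bndN (bndX n q0 hD))) _.
  by apply: le_trans hn; rewrite le_eqVlt; apply/orP; left; apply/eqP; ring.
- have -> : B * (1 - D) - 1 = - ((A n - B) * (1 - D)) - D ^+ n.
    by rewrite mulrBl hr [- (1 - _ - _)]opprB opprB -addrA addrAC subrr sub0r.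
  have qn0 : 0 <= 1 * q ^+ n / (1 - q) by rewrite mul1r divr_ge0 ?exprn_ge0 ?(ltW q1').
  apply: bnd_le (bndD (bndN (bndM qn0 (hB n) h1D)) (bndN (bndX n q0 hD))) _.
  by apply: le_trans hn; rewrite le_eqVlt; apply/orP; left; apply/eqP; ring.
Qed.

End Operators.

(** * Self-adjoint operators and their spectra *)

Section Order.
Context {R : realType} {H : hilbertType R}.
Implicit Types (A B C D : 'B(H)) (x y : H).
Local Notation Id := (1 : 'B(H)).

(* Only meant for self-adjoint [A], whose form is real. *)
Definition qf A x : R := ri (A x) x.

(** Recovers the complex form from the real one, so that identities on [inner] reduce to identities
    on [ri]. *)
Lemma Im_inner x y : complex.Im (inner x y) = ri x ('i *: y).
Proof.
rewrite /ri innerZr; case: (inner x y) => a b /=.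
by rewrite mul0r sub0r mulN1r opprK.
Qed.

Lemma ri_ii x y : ri ('i *: x) ('i *: y) = ri x y.
Proof.
rewrite /ri innerZr innerZl; case: (inner x y) => a b /=.
by rewrite !mul0r !mul1r !sub0r add0r mulN1r opprK.
Qed.

Lemma scale_ii x : 'i *: ('i *: x) = - x.
Proof. by rewrite scalerA -expr2 sqr_i scaleN1r. Qed.

Lemma sa_riP A : self_adjoint A <-> (forall x y, ri (A x) y = ri x (A y)).
Proof.
split=> [h x y|h x y]; first by rewrite /ri h.
apply/eqP; rewrite eq_complex; apply/andP; split; apply/eqP; first exact: h.
by rewrite !Im_inner h op_vE.
Qed.

Lemma sa0 : self_adjoint (0 : 'B(H)).
Proof. by move=> x y; rewrite !op0 linear0l linear0r. Qed.

Lemma sa1 : self_adjoint (1 : 'B(H)).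
Proof. by []. Qed.

Lemma saD A B : self_adjoint A -> self_adjoint B -> self_adjoint (A + B).
Proof. by move=> hA hB x y; rewrite !opE linearDl linearDr/= hA hB. Qed.

Lemma saZ (a : R) A : self_adjoint A -> self_adjoint (a%:C *: A).
Proof. by move=> hA x y; rewrite !opE innerZl innerZr hA conjc_real. Qed.

Lemma saN A : self_adjoint A -> self_adjoint (- A).
Proof. by move=> hA; rewrite -scaleN1r -(rmorphN1 (real_complex R)); exact: saZ. Qed.

Lemma saB A B : self_adjoint A -> self_adjoint B -> self_adjoint (A - B).
Proof. by move=> hA hB; apply: saD => //; exact: saN. Qed.

Lemma sa_scalar (a : R) : self_adjoint (a%:C *: Id).
Proof. exact/saZ/sa1. Qed.

Lemma saX A n : self_adjoint A -> self_adjoint (A ^+ n).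
Proof.
move=> hA; elim: n => [|n ih]; first exact: sa1.
by move=> x y; rewrite exprS opM hA ih -opM -exprSr exprS.
Qed.

Lemma sa_sum I (r : seq I) (P : pred I) (F : I -> 'B(H)) :
  (forall i, P i -> self_adjoint (F i)) -> self_adjoint (\sum_(i <- r | P i) F i).
Proof. by move=> h; elim/big_ind: _ => //; [exact: sa0|exact: saD]. Qed.

Lemma qfD A B x : qf (A + B) x = qf A x + qf B x.
Proof. by rewrite /qf opE riE. Qed.

Lemma qfN A x : qf (- A) x = - qf A x.
Proof. by rewrite /qf opE riE. Qed.

Lemma qfZ (a : R) A x : qf (a%:C *: A) x = a * qf A x.
Proof. by rewrite /qf opE riE. Qed.

Lemma qf1 x : qf 1 x = nm x ^+ 2.
Proof. by rewrite /qf op1 rixx. Qed.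

Definition qfE := (qfD, qfN, qfZ, qf1).

Lemma positive_qf A x : positive_op A -> 0 <= qf A x.
Proof. by move=> /(_ x); rewrite lecE => /andP[]. Qed.

Lemma positiveP A : self_adjoint A ->
  (positive_op A <-> forall x, 0 <= qf A x).
Proof.
move=> hA; split=> [h x|h x]; first exact: positive_qf.
rewrite lecE; apply/andP; split; last exact: h.
have := hA x x; rewrite [RHS]innerC; case: (inner (A x) x) => a b [] h'.
by apply/eqP => /=; lra.
Qed.

Lemma le_opP A B : self_adjoint A -> self_adjoint B ->
  (le_op A B <-> forall x, qf A x <= qf B x).
Proof.
move=> hA hB; rewrite /le_op (positiveP (saB hB hA)).
by split=> h x; have := h x; rewrite !qfE subr_ge0.
Qed.

(** Polarization: [inner (A x) x] is real, so [ri (A x) ('i *: x)] vanishes. Expanding at [x + y]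
    gives an antisymmetric form, and replacing [y] by ['i *: y] turns antisymmetry into
    self-adjointness. *)
Lemma positive_sa A : positive_op A -> self_adjoint A.
Proof.
move=> hA; have h0 x : ri (A x) ('i *: x) = 0.
  by rewrite -Im_inner; have := hA x; rewrite lecE => /andP[/eqP -> _].
have hp x y : ri (A x) ('i *: y) = - ri (A y) ('i *: x).
  have := h0 (x + y); rewrite op_vD scalerDr !riE !h0; lra.
apply/sa_riP => x y; have := hp x ('i *: y).
by rewrite scale_ii riNr op_vZ ri_ii => /oppr_inj ->; rewrite riC.
Qed.

Lemma qf_bnd A (c : R) x : bnd A c -> `|qf A x| <= c * nm x ^+ 2.
Proof.
move=> hA; apply: le_trans (ri_CauchySchwarz _ _) _.
by rewrite expr2 mulrA ler_wpM2r ?nm_ge0.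
Qed.

(* The form of [A] is nonnegative at [x - N^-1 A x]. *)
Lemma nm_sqr_le_qf A (N : R) x : self_adjoint A -> 0 < N ->
  (forall y, 0 <= qf A y <= N * nm y ^+ 2) -> nm (A x) ^+ 2 <= N * qf A x.
Proof.
move=> /sa_riP hA N0 h.
have /andP[+ _] := h (x + (- N^-1)%:C *: A x).
have /andP[_ h2] := h (A x); move: h2.
rewrite /qf !op_vE !riE (hA (A x) x) rixx => h2 h1.
have Ni : N^-1 * N = 1 by rewrite mulVf ?gt_eqF.
have : 0 <= ri (A x) x - 2 * N^-1 * nm (A x) ^+ 2 + N^-1 ^+ 2 * (N * nm (A x) ^+ 2).
  by have := ler_wpM2l (sqr_ge0 N^-1) h2; lra.
rewrite [_ ^+ 2 * (_ * _)]mulrA [N^-1 ^+ 2]expr2 -(mulrA N^-1) Ni mulr1 => h3.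
have : 0 <= ri (A x) x - N^-1 * nm (A x) ^+ 2 by lra.
by rewrite subr_ge0 ler_pdivrMl.
Qed.

(** [nm_sqr_le_qf] applied to [A + e], whose form lies between [0] and [2 * e]: the terms in
    [qf A x] cancel and leave [nm (A x) ^+ 2 <= e ^+ 2 * nm x ^+ 2]. *)
Lemma bnd_of_qf A (e : R) : self_adjoint A -> 0 < e ->
  (forall x, `|qf A x| <= e * nm x ^+ 2) -> bnd A e.
Proof.
move=> hA e0 h x.
have := @nm_sqr_le_qf (A + e%:C *: Id) (2 * e) x.
have hs : self_adjoint (A + e%:C *: Id) by apply: saD => //; exact: sa_scalar.
have e2 : 0 < 2 * e by lra.
move=> /(_ hs e2) h'; have {h'} := h' _.
have h'' y : 0 <= qf (A + e%:C *: Id) y <= 2 * e * nm y ^+ 2.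
  by have := h y; rewrite !qfE ler_norml => /andP[h1 h2]; apply/andP; split; lra.
move=> /(_ h''); rewrite !qfE -rixx !opE !riE !rixx (riC x) -/(qf A x) => h3.
rewrite -ler_sqr ?nnegrE ?mulr_ge0 ?nm_ge0 ?(ltW e0)//.
by rewrite exprMn; lra.
Qed.

Lemma invertible_mul A B :
  invertible_op A -> invertible_op B -> invertible_op (A * B).
Proof.
move=> [A' [hA hA']] [B' [hB hB']]; exists (B' * A'); split.
  by rewrite mulrA -(mulrA A) hB mulr1.
by rewrite mulrA -(mulrA B') hA' mulr1.
Qed.

Lemma invertible_scale (k : R[i]) A : k != 0 ->
  invertible_op A -> invertible_op (k *: A).
Proof.
move=> k0 [A' [hA hA']]; exists (k^-1 *: A').
by rewrite !(op_mulZl, op_mulZr) !scalerA hA hA' divff// scale1r.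
Qed.

(** The form of [A] lies between [c] and a bound [N], so [1 - A / (N + c)] has its form bounded by
    [N / (N + c) < 1] and the Neumann series inverts [A / (N + c)]. *)
Lemma coercive_invertible A (c : R) : self_adjoint A -> 0 < c ->
  (forall x, c * nm x ^+ 2 <= qf A x) -> invertible_op A.
Proof.
move=> hA c0 hc; have [N N0 hN] := bnd_ex A.
have Nc0 : 0 < N + c by rewrite addr_gt0.
pose D : 'B(H) := 1 - (N + c)^-1%:C *: A.
have hD : bnd D (N / (N + c)).
  apply: bnd_of_qf; [|exact: divr_gt0|].
    by apply: saB; [exact: sa1|exact: saZ].
  move=> x; rewrite !qfE.
  have h1 := hc x; have h2 := le_trans (ler_norm _) (qf_bnd x hN).
  have -> : nm x ^+ 2 - (N + c)^-1 * qf A x =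
      ((N + c) * nm x ^+ 2 - qf A x) / (N + c) by field; rewrite gt_eqF.
  have n0 : 0 <= c * nm x ^+ 2 by rewrite mulr_ge0 ?sqr_ge0 ?ltW.
  rewrite mulrAC normrM [`|(N + c)^-1|]gtr0_norm ?invr_gt0//.
  rewrite ler_wpM2r ?invr_ge0 ?(ltW Nc0)// ler_norml.
  by apply/andP; split; lra.
have : invertible_op (1 - D).
  by apply: neumann hD; rewrite ?divr_ge0 ?ltW// ltr_pdivrMr// mul1r ltrDl.
move=> /(@invertible_scale (N + c)%:C _ _).
rewrite opprB addrCA subrr addr0 scalerA -rmorphM /= mulfV ?gt_eqF//.
rewrite rmorph1 scale1r; apply.
  by [].
by rewrite ltcR.
Qed.

Lemma scalar_subr_sqr A (w : R[i]) :
  (A - w *: Id) * (A + w *: Id) = A ^+ 2 - (w * w) *: Id.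
Proof.
rewrite mulrBl !mulrDr !(op_mulZl, op_mulZr) !mul1r mulr1 scalerA -expr2.
by rewrite opprD addrA addrK.
Qed.

(** For [z = a + i b] with [b] nonzero and [B = A - a], the product of [B - i b] and [B + i b] is
    [B ^+ 2 + b ^+ 2], which is coercive with constant [b ^+ 2]. *)
Lemma sa_spectrum_real A z : self_adjoint A -> spectrum A z ->
  z = (complex.Re z)%:C.
Proof.
case: z => a b hA hz /=; apply/eqP; rewrite eq_complex /= eqxx /=.
apply/negPn/negP => b0; apply: hz.
pose B : 'B(H) := A - a%:C *: Id.
have hB : self_adjoint B by apply: saB => //; exact: sa_scalar.
pose w : R[i] := b *i.
have w2 : w * w = - (b ^+ 2)%:C by rewrite /w; simpc; rewrite expr2.
have -> : A - (a +i* b) *: Id = B - w *: Id.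
  rewrite /B -addrA -opprD -scalerDl; congr (_ - _ *: _).
  by rewrite /w; simpc.
have e1 : (B - w *: Id) * (B + w *: Id) = B ^+ 2 + (b ^+ 2)%:C *: Id.
  by rewrite scalar_subr_sqr w2 scaleNr opprK.
have e2 : (B + w *: Id) * (B - w *: Id) = B ^+ 2 + (b ^+ 2)%:C *: Id.
  have := scalar_subr_sqr B (- w); rewrite !scaleNr opprK => ->.
  by rewrite mulrNN w2 scaleNr opprK.
have [] : invertible_op (B ^+ 2 + (b ^+ 2)%:C *: Id).
  apply: (@coercive_invertible _ (b ^+ 2)).
  - by apply: saD; [exact: saX|exact: sa_scalar].
  - by rewrite exprn_even_gt0.
  - move=> x; rewrite !qfE lerDr /qf expr2 opM; have /sa_riP -> := hB.
    by rewrite rixx sqr_ge0.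
move=> G [G1 G2].
(* [G * (B + w)] is a left inverse of [B - w] and [(B + w) * G] a right inverse, hence they are
   equal. *)
have l1 : G * (B + w *: Id) * (B - w *: Id) = 1 by rewrite -mulrA e2.
exists ((B + w *: Id) * G); split; first by rewrite mulrA e1.
have -> : (B + w *: Id) * G = G * (B + w *: Id).
  by rewrite -[LHS]mul1r -{1}l1 -mulrA (mulrA (B - _)) e1 G1 mulr1.
exact: l1.
Qed.

(** For [t] outside the segment, [A - t] or its opposite is coercive. *)
Lemma sa_spectrum_in A (a b : R) : self_adjoint A ->
  (forall x, a * nm x ^+ 2 <= qf A x <= b * nm x ^+ 2) ->
  spectrum_in A `[a, b].
Proof.
move=> hA h z hz; have zE := sa_spectrum_real hA hz; exists (complex.Re z) => //.
move: (complex.Re z) zE hz => t -> hz {z}; rewrite /= in_itv /=.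
rewrite -[_ && _]negbK negb_and -!ltNge; apply/negP => /orP[ta|bt]; apply: hz.
  apply: (@coercive_invertible _ (a - t)); rewrite ?subr_gt0//.
    by apply: saB => //; exact: sa_scalar.
  by move=> x; rewrite !qfE mulrBl; have /andP[? _] := h x; lra.
rewrite -opprB -scaleN1r; apply: invertible_scale; first by rewrite oppr_eq0 oner_eq0.
apply: (@coercive_invertible _ (t - b)); rewrite ?subr_gt0//.
  by apply: saB => //; exact: sa_scalar.
by move=> x; rewrite !qfE mulrBl; have /andP[_ ?] := h x; lra.
Qed.

(* The witness is the infimum [- t0] of the numerical range: if [A + t0] were
   invertible, then [nm_sqr_le_qf] would make its form coercive. *)
Lemma negative_spectrum A : self_adjoint A -> ~ positive_op A ->
  exists2 t : R, t < 0 & spectrum A t%:C.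
Proof.
move=> hA npos.
pose E : set R := [set t | forall x, 0 <= qf A x + t * nm x ^+ 2].
have [N N0 hN] := bnd_ex A.
have EN : E N.
  by move=> x; have := qf_bnd x hN; rewrite ler_norml => /andP[? _]; lra.
have npos0 : ~ E 0.
  by move=> h; apply: npos; apply/positiveP => // x; have := h x; lra.
have E_up s t : E s -> s <= t -> E t.
  move=> hs st x; apply: le_trans (hs x) _.
  by rewrite lerD2l ler_wpM2r ?sqr_ge0.
have E_lb : lbound E 0.
  by move=> t Et; rewrite leNgt; apply/negP => /ltW t0; exact: npos0 (E_up _ _ Et t0).
have hE : has_inf E by split; [exists N|exists 0].
pose t0 := inf E.
have E_t0 : E t0.
  move=> x; apply/ler_addgt0Pr => e e0.
  have d0 : 0 < nm x ^+ 2 + 1 by rewrite ltr_wpDl ?sqr_ge0.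
  have [t Et tlt] := inf_adherent (divr_gt0 e0 d0) hE.
  have : t * nm x ^+ 2 <= (t0 + e / (nm x ^+ 2 + 1)) * nm x ^+ 2.
    by rewrite ler_wpM2r ?sqr_ge0// ltW.
  have : e / (nm x ^+ 2 + 1) * nm x ^+ 2 <= e.
    by rewrite -mulrA ler_piMr ?(ltW e0)// mulrC ler_pdivrMr// mul1r lerDl.
  by have := Et x; rewrite mulrDl; lra.
have t0gt : 0 < t0.
  rewrite lt_neqAle; apply/andP; split; last exact: lb_le_inf (proj1 hE) E_lb.
  by apply/eqP => t00; apply: npos0; rewrite t00.
exists (- t0); first by rewrite oppr_lt0.
move=> []; rewrite rmorphN /= scaleNr opprK => B [_ hB].
set D := A + t0%:C *: Id in hB.
have hD : self_adjoint D by apply: saD => //; exact: sa_scalar.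
have [c c0 hc] := bnd_ex B; have [M M0 hM] := bnd_ex D.
(* The inverse [B] bounds [nm x] by [nm (D x)], and [nm_sqr_le_qf] bounds the latter by the form of
   [D]. The shift [t0] could thus be lowered within [E]. *)
have key x : (c ^+ 2 * M)^-1 * nm x ^+ 2 <= qf D x.
  have h1 : nm x <= c * nm (D x) by have := hc (D x); rewrite -opM hB.
  have h2 : nm (D x) ^+ 2 <= M * qf D x.
    apply: nm_sqr_le_qf => // y; apply/andP; split.
      by rewrite !qfE; exact: E_t0.
    exact: le_trans (ler_norm _) (qf_bnd y hM).
  rewrite ler_pdivrMl; last by rewrite mulr_gt0 ?exprn_gt0.
  rewrite -mulrA; apply: le_trans (ler_wpM2l (sqr_ge0 c) h2).
  by rewrite -exprMn ler_sqr ?nnegrE ?mulr_ge0 ?nm_ge0 ?(ltW c0).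
have k0 : 0 < (c ^+ 2 * M)^-1 by rewrite invr_gt0 mulr_gt0 ?exprn_gt0.
have : E (t0 - (c ^+ 2 * M)^-1).
  by move=> x; have := key x; rewrite !qfE mulrBl; lra.
by move=> /(ge_inf (proj2 hE)); rewrite -/t0; lra.
Qed.

Lemma spectrum_shift A (a t : R) :
  spectrum (A - a%:C *: Id) t%:C -> spectrum A (a + t)%:C.
Proof. by rewrite /spectrum /= rmorphD scalerDl opprD addrA. Qed.

Lemma le_op_antisym A B : self_adjoint A -> self_adjoint B ->
  le_op A B -> le_op B A -> A = B.
Proof.
move=> hA hB /(le_opP hA hB) h1 /(le_opP hB hA) h2.
apply/eqP; rewrite -subr_eq0; apply/eqP; apply: bnd_small => e e0.
apply: bnd_of_qf => //; first exact: saB.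
move=> x; rewrite !qfE; have -> : qf A x = qf B x by apply: le_anti; rewrite h1 h2.
by rewrite subrr normr0 mulr_ge0 ?sqr_ge0 ?ltW.
Qed.

End Order.

(** * Functional calculus *)

Section PolynomialCalculus.
Context {R : realType} {H : hilbertType R}.
Implicit Types (A B : 'B(H)) (x y : H) (p q : {poly R}) (P Q : {poly R[i]}).
Local Notation Id := (1 : 'B(H)).

(** Complex coefficients give access to the factorization into linear factors. *)
Definition cpoly_op P A : 'B(H) := \sum_(i < size P) P`_i *: A ^+ i.

Lemma cpoly_opE P A n : (size P <= n)%N ->
  cpoly_op P A = \sum_(i < n) P`_i *: A ^+ i.
Proof.
move=> hn; rewrite /cpoly_op (big_ord_widen n (fun i => P`_i *: A ^+ i) hn).
rewrite [RHS](bigID (fun i : 'I_n => (i < size P)%N)) /=.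
rewrite [X in _ + X]big1 ?addr0// => i; rewrite -leqNgt => hi.
by rewrite nth_default// scale0r.
Qed.

Lemma poly_op_complex p A : poly_op p A = cpoly_op (map_poly (real_complex R) p) A.
Proof.
rewrite /poly_op /cpoly_op size_map_poly; apply: eq_bigr => i _.
by rewrite coef_map.
Qed.

Lemma cpoly_opD P Q A : cpoly_op (P + Q) A = cpoly_op P A + cpoly_op Q A.
Proof.
pose n := maxn (size P) (size Q).
rewrite (@cpoly_opE (P + Q) A n) ?size_polyD//.
rewrite (@cpoly_opE P A n) ?leq_maxl// (@cpoly_opE Q A n) ?leq_maxr//.
by rewrite -big_split /=; apply: eq_bigr => i _; rewrite coefD scalerDl.
Qed.

Lemma cpoly_opZ (k : R[i]) P A : cpoly_op (k *: P) A = k *: cpoly_op P A.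
Proof.
rewrite (@cpoly_opE (k *: P) A (size P)) ?size_scale_leq// /cpoly_op scaler_sumr.
by apply: eq_bigr => i _; rewrite coefZ scalerA.
Qed.

Lemma cpoly_opC (k : R[i]) A : cpoly_op k%:P A = k *: Id.
Proof.
rewrite (@cpoly_opE _ A 1%N) ?size_polyC_leq1// big_ord_recl big_ord0 addr0.
by rewrite coefC expr0.
Qed.

Lemma cpoly_opMX P A : cpoly_op (P * 'X) A = cpoly_op P A * A.
Proof.
rewrite (@cpoly_opE _ A (size P).+1); last first.
  by rewrite (leq_trans (size_polyMleq _ _))// size_polyX addn2.
rewrite big_ord_recl coefMX /= scale0r add0r /cpoly_op mulr_suml.
apply: eq_bigr => i _; rewrite coefMX /= op_mulZl; congr (_ *: _).
by rewrite exprSr.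
Qed.

Lemma cpoly_opX A : cpoly_op 'X A = A.
Proof. by rewrite -['X]mul1r cpoly_opMX cpoly_opC scale1r mul1r. Qed.

Lemma cpoly_opM P Q A : cpoly_op (P * Q) A = cpoly_op P A * cpoly_op Q A.
Proof.
elim/poly_ind: Q => [|Q c ih].
  by rewrite mulr0 /cpoly_op size_poly0 big_ord0 mulr0.
rewrite mulrDr mulrA !cpoly_opD !cpoly_opMX ih mulrDr mulrA; congr (_ + _).
by rewrite mulrC mul_polyC cpoly_opZ cpoly_opC op_mulZr mulr1.
Qed.

Lemma poly_opD p q A : poly_op (p + q) A = poly_op p A + poly_op q A.
Proof. by rewrite !poly_op_complex rmorphD cpoly_opD. Qed.

Lemma poly_opM p q A : poly_op (p * q) A = poly_op p A * poly_op q A.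
Proof. by rewrite !poly_op_complex rmorphM cpoly_opM. Qed.

Lemma poly_opC (a : R) A : poly_op a%:P A = a%:C *: Id.
Proof. by rewrite poly_op_complex map_polyC cpoly_opC. Qed.

Lemma poly_opX A : poly_op 'X A = A.
Proof. by rewrite poly_op_complex map_polyX cpoly_opX. Qed.

Lemma poly_opN p A : poly_op (- p) A = - poly_op p A.
Proof.
by rewrite !poly_op_complex rmorphN -scaleN1r cpoly_opZ scaleN1r.
Qed.

Lemma poly_opB p q A : poly_op (p - q) A = poly_op p A - poly_op q A.
Proof. by rewrite poly_opD poly_opN. Qed.

Lemma sa_poly_op p A : self_adjoint A -> self_adjoint (poly_op p A).
Proof. by move=> hA; apply: sa_sum => i _; exact/saZ/saX. Qed.

(** Over an algebraically closed field [P] is a product of factors ['X - z]; each root [z] is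
    outside the spectrum, so each [A - z] is invertible. *)
Lemma invertible_cpoly P A : P != 0 ->
  (forall z, spectrum A z -> ~~ root P z) -> invertible_op (cpoly_op P A).
Proof.
move=> P0 hP; have [r Pr] := closed_field_poly_normal P.
have {}hP z : z \in r -> invertible_op (A - z *: Id).
  move=> zr; apply: contrapT => /hP /negP; apply.
  rewrite Pr rootZ ?lead_coef_eq0// root_prod_XsubC//.
rewrite Pr cpoly_opZ; apply: invertible_scale; first by rewrite lead_coef_eq0.
elim: r hP {Pr} => [|z r ih] hP.
  by rewrite big_nil cpoly_opC scale1r; exists 1; rewrite mulr1.
rewrite big_cons cpoly_opM; apply: invertible_mul; last first.
  by apply: ih => w wr; apply: hP; rewrite in_cons wr orbT.
rewrite cpoly_opD -polyCN cpoly_opX cpoly_opC scaleNr.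
by apply: hP; rewrite in_cons eqxx.
Qed.

(* A negative spectral value [t] of [p(A)] makes some linear factor of [p - t]
   singular at [A], that is, [p] takes the value [t] on the spectrum of [A]. *)
Lemma poly_op_ge0 p A : self_adjoint A ->
  (forall t : R, spectrum A t%:C -> 0 <= p.[t]) -> positive_op (poly_op p A).
Proof.
move=> hA hp; apply: contrapT => hneg.
have [t t0] := negative_spectrum (sa_poly_op p hA) hneg; apply.
pose q := p - t%:P.
have -> : poly_op p A - t%:C *: Id = poly_op q A by rewrite poly_opB poly_opC.
rewrite poly_op_complex; apply: invertible_cpoly; last first.
  move=> z hz; have zE := sa_spectrum_real hA hz; rewrite zE in hz *.
  rewrite fmorph_root /root /q !hornerE /=.
  by have := hp _ hz => h; rewrite gt_eqF//; lra.
(* A constant [p] has no linear factor, so a point of the spectrum of [A] must be found. The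
   operator [A - (N + 1)] is not positive, as otherwise every vector would be zero and [p(A)]
   positive; [negative_spectrum] then gives the point. *)
rewrite map_poly_eq0; apply/negP => /eqP q0.
have pt : p = t%:P by apply/eqP; rewrite -subr_eq0 -/q q0.
have [N N0 hN] := bnd_ex A.
have hAN : ~ positive_op (A - (N + 1)%:C *: Id).
  move=> h; apply: hneg => x.
  have := positive_qf x h; have := le_trans (ler_norm _) (qf_bnd x hN).
  rewrite !qfE => h1 h2; have /eqP : nm x ^+ 2 = 0.
    by apply: le_anti; rewrite sqr_ge0 andbT; lra.
  by rewrite sqrf_eq0 => /eqP/nm_eq0 ->; rewrite linear0r.
have [|s s0 hs] := negative_spectrum _ hAN; first exact: saB hA (sa_scalar _).
by have /hp := spectrum_shift hs; rewrite pt hornerC; lra.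
Qed.

Lemma poly_op_qf p A (e : R) x : self_adjoint A ->
  (forall t : R, spectrum A t%:C -> - e <= p.[t]) ->
  - e * nm x ^+ 2 <= qf (poly_op p A) x.
Proof.
move=> hA h; have : positive_op (poly_op (p + e%:P) A).
  by apply: poly_op_ge0 => // t /h; rewrite !hornerE; lra.
by move=> /(positive_qf x); rewrite poly_opD poly_opC !qfE; lra.
Qed.

Lemma poly_op_bnd p A (e : R) : self_adjoint A -> 0 < e ->
  (forall t : R, spectrum A t%:C -> `|p.[t]| <= e) -> bnd (poly_op p A) e.
Proof.
move=> hA e0 h; apply: bnd_of_qf => //; first exact: sa_poly_op.
move=> x; rewrite ler_norml; apply/andP; split.
  rewrite -mulNr; apply: poly_op_qf => // t /h; rewrite ler_norml.
  by move=> /andP[].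
have := @poly_op_qf (- p) A e x hA; rewrite poly_opN qfN mulNr lerN2; apply.
by move=> t /h; rewrite hornerN lerN2 ler_norml => /andP[].
Qed.

End PolynomialCalculus.

(** * Polynomial approximation on a segment *)

Section Weierstrass.
Context {R : realType}.
Implicit Types (f g : R -> R) (u v : nat -> R) (x y t : R).

(* The Bernstein polynomial [\sum_k 'C(n, k) x^k (1 - x)^(n - k) u(k)]; the
   recursion conditions on the first Bernoulli trial. *)
Fixpoint binomial_mean n u : {poly R} :=
  if n is n'.+1 then
    (1 - 'X) * binomial_mean n' u + 'X * binomial_mean n' (u \o succn)
  else (u 0%N)%:P.

Lemma binomial_meanS n u x : (binomial_mean n.+1 u).[x] =
  (1 - x) * (binomial_mean n u).[x] + x * (binomial_mean n (u \o succn)).[x].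
Proof. by rewrite /= !hornerE. Qed.

Lemma binomial_mean_le n u v x : 0 <= x <= 1 ->
  (forall k, (k <= n)%N -> u k <= v k) ->
  (binomial_mean n u).[x] <= (binomial_mean n v).[x].
Proof.
move=> /andP[x0 x1]; elim: n u v => [|n ih] u v h.
  by rewrite !hornerC; exact: h.
rewrite !binomial_meanS lerD// ler_wpM2l ?subr_ge0//; apply: ih => k kn.
  by apply: h; rewrite ltnW.
exact: h.
Qed.

Lemma binomial_mean_affine n u (a b : R) x :
  (binomial_mean n (fun k => a * u k + b)).[x] = a * (binomial_mean n u).[x] + b.
Proof.
elim: n u => [|n ih] u; first by rewrite !hornerC.
by rewrite !binomial_meanS ih (ih (u \o succn)); ring.
Qed.

(** Squared mean plus variance of a shifted binomial variable. The shift [c] is general because the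
    recursion moves it by one; at [c = - (n%:R * x)] only the variance remains. *)
Lemma binomial_mean_sqr n x (c : R) :
  (binomial_mean n (fun k => (k%:R + c) ^+ 2)).[x] =
  (n%:R * x + c) ^+ 2 + n%:R * (x * (1 - x)).
Proof.
elim: n c => [|n ih] c; first by rewrite hornerC; ring.
rewrite binomial_meanS ih.
rewrite [X in binomial_mean n X](_ : _ = (fun k => (k%:R + (c + 1)) ^+ 2)).
  by rewrite ih -[in RHS]natr1; ring.
by apply/funext => k /=; rewrite -natr1; congr (_ ^+ 2); ring.
Qed.

Lemma within_continuousP (D : set R) f : {within D, continuous f} <->
  (forall x, D x -> forall e : R, 0 < e ->
    exists2 d : R, 0 < d & forall y, D y -> `|x - y| < d -> `|f x - f y| < e).
Proof.
rewrite subspace_continuousP; split=> h x Dx.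
  move=> e e0; have /cvgrPdist_lt /(_ _ e0) := h x Dx.
  by move=> /nbhs_ballP [d /= d0 hd]; exists d => // y Dy xy; exact: hd.
apply/cvgrPdist_lt => e e0; have [d d0 hd] := h x Dx e e0.
by apply/nbhs_ballP; exists d => //= y xy Dy; exact: hd.
Qed.

(** Close points are handled by continuity, distant ones by boundedness of [f], and compactness
    makes [C] uniform. The error is quadratic because [binomial_mean_sqr] averages squares
    exactly. *)
Lemma continuous_quadratic_modulus f (e : R) : 0 < e ->
  {within `[0, 1], continuous f} ->
  exists2 C : R, 0 < C & forall x y, 0 <= x <= 1 -> 0 <= y <= 1 ->
    `|f x - f y| <= e + C * (x - y) ^+ 2.
Proof.
move=> e0 cf.
have cpt : compact `[0, 1 : R] by exact: segment_compact.
have [M M0 hM] : exists2 M : R, 0 < M & forall x, 0 <= x <= 1 -> `|f x| <= M.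
  have /compact_bounded [N [_ hN]] := continuous_compact cf cpt.
  exists (`|N| + 1); first by rewrite ltr_wpDl.
  move=> x hx; apply: (hN (`|N| + 1)); last by exists x => //=; rewrite in_itv.
  by rewrite ltr_pwDr// ler_norm.
have /compact_near_coveringP/near_covering_withinP := cpt.
pose P (C x : R) := forall y, 0 <= y <= 1 -> `|f x - f y| <= e + C * (x - y) ^+ 2.
move=> /(_ R (pinfty_nbhs R) P _) h.
have : \forall C \near +oo, `[0, 1] `<=` P C.
  apply: h => x hx.
  have [|d d0 hd] := (within_continuousP _ f).1 cf x hx (e / 2).
    by rewrite divr_gt0.
  have d2 : 0 < d / 2 by rewrite divr_gt0.
  (* When [y] is at least [d / 2] away from [x'], this constant times [(d / 2) ^+ 2] is [2 * M], a
     bound on the oscillation of [f]. Otherwise [x'] and [y] are both within [d] of [x]. *)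
  have K0 : 0 <= 8 * M / d ^+ 2.
    by rewrite divr_ge0 ?sqr_ge0// mulr_ge0 ?(ltW M0).
  exists (ball x (d / 2), [set C | 8 * M / d ^+ 2 <= C]).
    split; first exact: nbhsx_ballx.
    by apply: nbhs_pinfty_ge; rewrite num_real.
  move=> [x' C] /= [hx' hC] x'01 y hy.
  have hd' z : `|x - z| < d -> 0 <= z <= 1 -> `|f x - f z| < e / 2.
    by move=> xz z01; apply: hd => //=; rewrite in_itv.
  have [yx|yx] := ltP `|x' - y| (d / 2).
    have h1 : `|f x - f x'| < e / 2.
      apply: hd'; last by rewrite in_itv in x'01.
      by apply: lt_le_trans hx' _; lra.
    have h2 : `|f x - f y| < e / 2.
      apply: hd' => //; apply: le_lt_trans (ler_distD x' _ _) _.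
      by have : `|x - x'| < d / 2 := hx'; lra.
    have C0 : 0 <= C.
      exact: le_trans hC.
    have : 0 <= C * (x' - y) ^+ 2 by rewrite mulr_ge0 ?sqr_ge0.
    have := ler_distD (f x) (f x') (f y); rewrite [`|f x' - f x|]distrC; lra.
  have x'01' : 0 <= x' <= 1 by rewrite in_itv in x'01.
  have h1 : `|f x' - f y| <= 2 * M.
    apply: le_trans (ler_normB _ _) _.
    by have := hM _ x'01'; have := hM _ hy; lra.
  have h2 : (d / 2) ^+ 2 <= (x' - y) ^+ 2.
    by rewrite -(real_normK (num_real (x' - y))) ler_sqr ?nnegrE ?(ltW d2).
  have h3 : 8 * M / d ^+ 2 * (d / 2) ^+ 2 <= C * (x' - y) ^+ 2.
    by rewrite ler_pM ?sqr_ge0.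
  have : 8 * M / d ^+ 2 * (d / 2) ^+ 2 = 2 * M by field; rewrite gt_eqF.
  lra.
move=> [N [_ hN]]; exists (`|N| + 1); first by rewrite ltr_wpDl.
move=> x y hx hy; have NN : N < `|N| + 1 by rewrite ltr_pwDr// ler_norm.
by apply: (hN _ NN x) => //=; rewrite in_itv.
Qed.

(** At [x], the error of the Bernstein polynomial is at most the mean of the quadratic modulus, that
    is [e / 2 + C / n * x * (1 - x)]. *)
Lemma weierstrass01 f (e : R) : 0 < e -> {within `[0, 1], continuous f} ->
  exists p : {poly R}, forall x, 0 <= x <= 1 -> `|p.[x] - f x| <= e.
Proof.
move=> e0 cf.
have [C C0 hC] := @continuous_quadratic_modulus f (e / 2) ltac:(by rewrite divr_gt0) cf.
have [n n0 hn] : exists2 n : nat, (0 < n)%N & C / n%:R <= e / 2.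
  pose n := (Num.truncn (C / (e / 2))).+1.
  exists n => //; rewrite ler_pdivrMr ?ltr0n// mulrC -ler_pdivrMr ?divr_gt0//.
  by rewrite ltW// truncnS_gt.
have nR : (n%:R : R) != 0 by rewrite pnatr_eq0 -lt0n.
have n0' : 0 < (n%:R : R) by rewrite ltr0n.
pose u k := f (k%:R / n%:R).
exists (binomial_mean n u) => x hx.
pose K := C / n%:R ^+ 2.
(* The cases [s = 1] and [s = -1] give the upper and the lower estimate. *)
have hV (s : R) : (binomial_mean n
    (fun k => (s * K) * (k%:R + - (n%:R * x)) ^+ 2 + (s * (e / 2) + f x))).[x] =
    s * (C / n%:R * (x * (1 - x)) + e / 2) + f x.
  by rewrite binomial_mean_affine binomial_mean_sqr /K; field.
have hx1 : C / n%:R * (x * (1 - x)) <= e / 2.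
  apply: le_trans hn; rewrite ler_piMr ?divr_ge0 ?(ltW C0) ?(ltW n0')//.
  by move: hx => /andP[? ?]; nra.
have hk k : (k <= n)%N -> `|f x - u k| <= e / 2 + K * (k%:R + - (n%:R * x)) ^+ 2.
  move=> kn; apply: le_trans (hC x (k%:R / n%:R) hx _) _.
    by rewrite divr_ge0 ?(ltW n0') ?ler0n//= ler_pdivrMr// mul1r ler_nat.
  rewrite lerD2l le_eqVlt; apply/orP; left; apply/eqP.
  by rewrite /K; field.
rewrite ler_norml; apply/andP; split.
  have := @binomial_mean_le n _ u x hx _; move=> /(_ (fun k =>
    (-1 * K) * (k%:R + - (n%:R * x)) ^+ 2 + (-1 * (e / 2) + f x))).
  rewrite hV => h; have {}h := h _; suff /h : forall k, (k <= n)%N ->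
    -1 * K * (k%:R - n%:R * x) ^+ 2 + (-1 * (e / 2) + f x) <= u k by lra.
  by move=> k /hk; rewrite ler_norml => /andP[_ ?]; lra.
have := @binomial_mean_le n u _ x hx _; move=> /(_ (fun k =>
  (1 * K) * (k%:R + - (n%:R * x)) ^+ 2 + (1 * (e / 2) + f x))).
rewrite hV => h; suff /h : forall k, (k <= n)%N ->
  u k <= 1 * K * (k%:R - n%:R * x) ^+ 2 + (1 * (e / 2) + f x) by lra.
by move=> k /hk; rewrite ler_norml => /andP[? _]; lra.
Qed.

Lemma weierstrass f (a b e : R) : a < b -> 0 < e ->
  {within `[a, b], continuous f} ->
  exists p : {poly R}, forall x, x \in `[a, b] -> `|p.[x] - f x| <= e.
Proof.
move=> ab e0 cf; pose h t := a + (b - a) * t.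
have h01 t : t \in `[0, 1] -> h t \in `[a, b].
  by rewrite !in_itv /= /h => /andP[? ?]; apply/andP; split; nra.
have ba : 0 < b - a by rewrite subr_gt0.
have cfh : {within `[0, 1], continuous (f \o h)}.
  apply/within_continuousP => x x01 r r0.
  have [d d0 hd] := (within_continuousP _ f).1 cf (h x) (h01 x x01) r r0.
  exists (d / (b - a)) => [|y y01 xy]; first exact: divr_gt0.
  apply: hd; first exact: h01.
  rewrite /h [X in `|X|](_ : _ = (b - a) * (x - y)); last by ring.
  by rewrite normrM gtr0_norm// -ltr_pdivlMl// mulrC.
have [p hp] := weierstrass01 e0 cfh.
exists (p \Po ((b - a)^-1 *: ('X - a%:P))) => x hx.
rewrite horner_comp !hornerE.
have := hp ((b - a)^-1 * (x - a)).
rewrite /= /h mulrA mulfV ?gt_eqF// mul1r [a + _]addrC subrK; apply.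
move: hx; rewrite in_itv /= => /andP[? ?].
rewrite mulr_ge0 ?invr_ge0 ?(ltW ba) ?subr_ge0//=.
by rewrite ler_pdivrMl// mulr1 lerB.
Qed.

End Weierstrass.

(** * Continuous functions of a self-adjoint operator *)

Section FunctionalCalculus.
Context {R : realType} {H : hilbertType R}.
Implicit Types (A B C : 'B(H)) (x y : H) (p q : {poly R}) (f g : R -> R).
Local Notation Id := (1 : 'B(H)).

Lemma op_norm_has_sup A :
  has_sup [set complex.Re `|A x| | x in [set x : H | `|x| <= 1]].
Proof.
split; first by exists 0; exists 0; rewrite /= ?normr0 ?op_v0 ?normr0 ?ler01.
have [c c0 hc] := bnd_ex A; exists c => _ [x /= x1 <-].
apply: le_trans (hc x) _; rewrite ler_piMr ?(ltW c0)//.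
by rewrite -lecR -nmE.
Qed.

Lemma bnd_op_norm A : bnd A (op_norm A).
Proof.
move=> x; have [x0|x0] := eqVneq (nm x) 0.
  by rewrite (nm_eq0 x0) op_v0 nm0 mulr0.
have x0' : 0 < nm x by rewrite lt_neqAle eq_sym x0 nm_ge0.
rewrite -ler_pdivrMr//.
have -> : nm (A x) / nm x = complex.Re `|A ((nm x)^-1%:C *: x)|.
  by rewrite -/(nm _) op_vE nmZR ger0_norm ?invr_ge0 ?nm_ge0// mulrC.
apply: ub_le_sup; first exact: (op_norm_has_sup A).2.
exists ((nm x)^-1%:C *: x) => //=.
rewrite nmE nmZR ger0_norm ?invr_ge0 ?nm_ge0// mulVf//.
Qed.

Lemma op_norm_ge0 A : 0 <= op_norm A.
Proof.
apply: ub_le_sup; first exact: (op_norm_has_sup A).2.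
by exists 0; rewrite /= ?normr0 ?op_v0 ?normr0 ?ler01.
Qed.

Lemma op_norm_le A (c : R) : 0 <= c -> bnd A c -> op_norm A <= c.
Proof.
move=> c0 hc; apply: ge_sup; first exact: (op_norm_has_sup A).1.
move=> _ [x /= x1 <-]; apply: le_trans (hc x) _.
by rewrite ler_piMr// -lecR -nmE.
Qed.

(* Equivalent to [is_fun_calc], but without sequences, so that limits of limits
   need no diagonal extraction. *)
Definition approx f A B := forall e : R, 0 < e -> exists2 p,
  (forall t : R, spectrum A t%:C -> `|p.[t] - f t| <= e) &
  bnd (poly_op p A - B) e.

Lemma is_fun_calc_approx f A B : is_fun_calc f A B -> approx f A B.
Proof.
move=> [p [pf pB]] e e0.
have h1 : \forall n \near \oo, forall t : R, spectrum A t%:C -> `|(p n).[t] - f t| <= e.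
  apply: (pf [set h : R -> R | forall t, spectrum A t%:C -> `|h t - f t| <= e]).
  apply/uniform_nbhs.
  exists [set xy : R * R | ball xy.1 e xy.2]; split.
    by rewrite -entourage_ballE; exists e.
  by move=> h hh t /hh; rewrite /= /ball /= distrC => /ltW.
have h2 : \forall n \near \oo, op_norm (poly_op (p n) A - B) <= e.
  move/cvgrPdist_le : pB => /(_ _ e0); apply: filterS => n.
  by rewrite sub0r normrN ger0_norm ?op_norm_ge0.
have [n [hn1 hn2]] : exists n, (forall t : R, spectrum A t%:C -> `|(p n).[t] - f t| <= e)
    /\ op_norm (poly_op (p n) A - B) <= e.
  by near \oo => n; exists n; split; near: n.
by exists (p n) => //; apply: bnd_le hn2; exact: bnd_op_norm.
Unshelve. all: by end_near.
Qed.

Lemma approx_is_fun_calc f A B : approx f A B -> is_fun_calc f A B.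
Proof.
move=> h.
have /choice[p hp] : forall n : nat, exists p,
  (forall t : R, spectrum A t%:C -> `|p.[t] - f t| <= n.+1%:R^-1) /\
  bnd (poly_op p A - B) n.+1%:R^-1.
  by move=> n; have [|p h1 h2] := h n.+1%:R^-1; [rewrite invr_gt0|exists p].
have small (e : R) : 0 < e -> \forall n \near \oo, n.+1%:R^-1 < e :> R.
  move=> e0; have /cvgrPdist_lt/(_ _ e0) := @cvg_harmonic R.
  by apply: filterS => n; rewrite sub0r normrN ger0_norm /harmonic /= ?invr_ge0.
exists p; split.
  move=> P /uniform_nbhs [E [+ EP]]; rewrite -entourage_ballE => -[e /= e0 eE].
  near=> n; apply: EP => t ht; apply: (eE (_, _)); rewrite /ball /= distrC.
  apply: le_lt_trans ((hp n).1 t ht) _; near: n; exact: small.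
apply/cvgrPdist_le => e e0; near=> n.
rewrite sub0r normrN ger0_norm ?op_norm_ge0//; apply: op_norm_le (ltW e0) _.
by apply: bnd_le (hp n).2 _; apply: ltW; near: n; exact: small.
Unshelve. all: by end_near.
Qed.

Lemma approx_sa f A B : self_adjoint A -> approx f A B -> self_adjoint B.
Proof.
move=> hA h; apply/sa_riP => x y; apply/eqP; rewrite -subr_eq0 -normr_le0.
apply/ler_addgt0Pr => e e0; rewrite add0r.
(* Two errors of size [e / K * nm x * nm y] add up to at most [e]; the added [1] keeps [K]
   positive. *)
pose K := 2 * nm x * nm y + 1.
have K0 : 0 < K by rewrite ltr_wpDl ?mulr_ge0 ?nm_ge0.
have [p _ hp] := h (e / K) (divr_gt0 e0 K0).
have /sa_riP hpA := sa_poly_op p hA.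
have h1 := ri_CauchySchwarz ((poly_op p A - B) x) y.
have h2 := ri_CauchySchwarz x ((poly_op p A - B) y).
have {}h1 := le_trans h1 (ler_wpM2r (nm_ge0 y) (hp x)).
have {}h2 := le_trans h2 (ler_wpM2l (nm_ge0 x) (hp y)).
move: h1 h2; rewrite !opE !riE hpA => h1 h2.
have -> : ri (B x) y - ri x (B y) =
   (ri x (poly_op p A y) - ri x (B y)) - (ri x (poly_op p A y) - ri (B x) y) by ring.
apply: le_trans (ler_normB _ _) _; apply: le_trans (lerD h2 h1) _.
have -> : nm x * (e / K * nm y) + e / K * nm x * nm y = e / K * (K - 1).
  by rewrite /K; ring.
rewrite mulrBr mulr1 mulfVK ?gt_eqF// gerBl divr_ge0 ?ltW//.
Qed.

(** Passage to the limit in the positivity of polynomials that are nonnegative on the spectrum.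
    Uniqueness and all spectral bounds on [f(A)] come from it. *)
Lemma approx_le f g A B C : self_adjoint A -> approx f A B -> approx g A C ->
  (forall t : R, spectrum A t%:C -> f t <= g t) -> le_op B C.
Proof.
move=> hA hB hC fg; apply/le_opP; [exact: approx_sa hB|exact: approx_sa hC|].
move=> x; rewrite -subr_ge0; apply/ler_addgt0Pr => e e0.
(* Four errors [d * nm x ^+ 2]: one for each of [B] and [C], and two because [q - p] is only at
   least [- (2 * d)] on the spectrum. *)
pose K := 4 * nm x ^+ 2 + 1.
have K0 : 0 < K by rewrite /K; have := sqr_ge0 (nm x); lra.
have d0 := divr_gt0 e0 K0; set d := e / K in d0.
have [p hp hpB] := hB d d0; have [q hq hqC] := hC d d0.
have h1 := qf_bnd x hpB; have h2 := qf_bnd x hqC.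
have h3 : - (2 * d) * nm x ^+ 2 <= qf (poly_op (q - p) A) x.
  apply: poly_op_qf => // t ht; rewrite hornerD hornerN.
  move: (hp t ht) (hq t ht) (fg t ht); rewrite !ler_norml.
  by move=> /andP[? ?] /andP[? ?] ?; lra.
move: h1 h2 h3; rewrite poly_opB !qfE !ler_norml => /andP[? ?] /andP[? ?] ?.
have : d * (4 * nm x ^+ 2) <= e.
  have -> : 4 * nm x ^+ 2 = K - 1 by rewrite /K addrK.
  by rewrite /d mulrBr mulr1 mulfVK ?gt_eqF// gerBl ltW.
lra.
Qed.

Lemma approx_unique f A B C : self_adjoint A ->
  approx f A B -> approx f A C -> B = C.
Proof.
move=> hA hB hC; apply: le_op_antisym.
- exact: approx_sa hB.
- exact: approx_sa hC.
- exact: approx_le hB hC _.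
- exact: approx_le hC hB _.
Qed.

(** The way to compute [fun_calc]: exhibit an [approx], which also rules out the placeholder [0]. *)
Lemma approx_fun_calc f A B : self_adjoint A -> approx f A B -> fun_calc f A = B.
Proof.
move=> hA hB; rewrite /fun_calc; case: xgetP => [C _ hC|]; last first.
  by move=> /(_ B) []; exact: approx_is_fun_calc.
by apply: approx_unique hA _ hB; exact: is_fun_calc_approx hC.
Qed.

Lemma eq_approx f g A B : (forall t : R, spectrum A t%:C -> f t = g t) ->
  approx f A B -> approx g A B.
Proof.
move=> fg h e e0; have [p hp hB] := h e e0; exists p => // t ht.
by rewrite -fg// hp.
Qed.

Lemma approx_poly p A : approx (horner p) A (poly_op p A).
Proof.
move=> e e0; exists p => [t _|x]; first by rewrite subrr normr0 ltW.
by rewrite subrr op0 nm0 mulr_ge0 ?nm_ge0 ?ltW.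
Qed.

Lemma approxD f g A B C : approx f A B -> approx g A C ->
  approx (fun t => f t + g t) A (B + C).
Proof.
move=> hB hC e e0; have e2 : 0 < e / 2 by rewrite divr_gt0.
have [p hp hpB] := hB _ e2; have [q hq hqC] := hC _ e2.
exists (p + q) => [t ht|].
  rewrite hornerD opprD addrACA; apply: le_trans (ler_normD _ _) _.
  by move: (hp t ht) (hq t ht); lra.
rewrite poly_opD opprD addrACA; apply: bnd_le (bndD hpB hqC) _; lra.
Qed.

Lemma approx_cst (k : R) A : approx (fun=> k) A (k%:C *: Id).
Proof.
rewrite -(poly_opC k A); apply: eq_approx (approx_poly _ _) => t _.
by rewrite hornerC.
Qed.

Lemma approxZ (k : R) f A B : approx f A B ->
  approx (fun t => k * f t) A (k%:C *: B).
Proof.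
move=> hB e e0; have k0 : 0 < `|k| + 1 by rewrite ltr_wpDl.
have [p hp hpB] := hB _ (divr_gt0 e0 k0).
have ke : `|k| * (e / (`|k| + 1)) <= e.
  by rewrite mulrCA ler_piMr ?(ltW e0)// ler_pdivrMr// mul1r lerDl.
exists (k%:P * p) => [t ht|].
  rewrite hornerM hornerC -mulrBr normrM; apply: le_trans ke.
  by rewrite ler_wpM2l// hp.
rewrite poly_opM poly_opC op_mulZl mul1r -scalerBr.
exact: bnd_le (bndZ k hpB) ke.
Qed.

Lemma approxM f g A B C (K : R) : self_adjoint A ->
  approx f A B -> approx g A C ->
  (forall t : R, spectrum A t%:C -> `|f t| <= K) ->
  (forall t : R, spectrum A t%:C -> `|g t| <= K) ->
  approx (fun t => f t * g t) A (B * C).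
Proof.
move=> hA hB hC fK gK e e0.
have [b b0 hb] := bnd_ex B; have [c c0 hc] := bnd_ex C.
(* The first three terms collect the scalar errors and the last ones the operator errors. Taking
   [d <= 1] below bounds [q] and [q(A)] by the bounds for [g] and [C] plus one. *)
pose L := `|K| + 1 + `|K| + (c + 1 + b).
have L0 : 0 < L by rewrite /L; have := normr_ge0 K; lra.
pose d := Num.min 1 (e / L).
have d0 : 0 < d by rewrite lt_min ltr01 divr_gt0.
have d1 : d <= 1 by rewrite ge_min lexx.
have dL : d * L <= e by rewrite -ler_pdivlMr// ge_min lexx orbT.
have [p hp hpB] := hB _ d0; have [q hq hqC] := hC _ d0.
exists (p * q) => [t ht|].
  have -> : (p * q).[t] - f t * g t = (p.[t] - f t) * q.[t] + f t * (q.[t] - g t).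
    by rewrite hornerM; ring.
  apply: le_trans (ler_normD _ _) _; rewrite !normrM.
  have h1 : `|q.[t]| <= `|K| + 1.
    rewrite -[q.[t]](subrK (g t)) addrC; apply: le_trans (ler_normD _ _) _.
    apply: lerD; first exact: le_trans (gK t ht) (ler_norm _).
    exact: le_trans (hq t ht) d1.
  have h2 : `|f t| <= `|K| by exact: le_trans (fK t ht) (ler_norm _).
  apply: le_trans (lerD (ler_pM _ _ (hp t ht) h1) (ler_pM _ _ h2 (hq t ht))) _ => //.
  by apply: le_trans dL; rewrite /L; have := normr_ge0 K; nra.
rewrite poly_opM.
have -> : poly_op p A * poly_op q A - B * C =
    (poly_op p A - B) * poly_op q A + B * (poly_op q A - C).
  by rewrite mulrBl mulrBr addrA subrK.
have hq' : bnd (poly_op q A) (c + 1).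
  rewrite -[poly_op q A](subrK C) addrC; apply: bndD => //.
  exact: bnd_le hqC d1.
apply: bnd_le (bndD (bndM (ltW d0) hpB hq') (bndM (ltW b0) hb hqC)) _.
by apply: le_trans dL; rewrite /L; have := normr_ge0 K; nra.
Qed.

(** Weierstrass polynomials with error [2^-1 ^+ n] differ consecutively by at most [2 * 2^-1 ^+ n],
    on the spectrum and therefore in norm at [A]. *)
Lemma approx_exists f A (a b : R) : self_adjoint A -> a < b ->
  spectrum_in A `[a, b] -> {within `[a, b], continuous f} ->
  exists B, approx f A B.
Proof.
move=> hA ab hsp cf.
have inab (t : R) : spectrum A t%:C -> t \in `[a, b].
  by move=> /hsp [s hs /complexI <-].
have /choice[p hp] : forall n : nat, exists p : {poly R},
    forall x : R, x \in `[a, b] -> `|p.[x] - f x| <= 2^-1 ^+ n.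
  by move=> n; apply: weierstrass => //; rewrite exprn_gt0.
have half1 : 2^-1 < 1 :> R by lra.
have half0 : 0 <= 2^-1 :> R by lra.
have [|B hB] := @bnd_geometric_cvg _ _ (fun n => poly_op (p n) A) 2 2^-1
  ltac:(by []) half0 half1.
  move=> n; rewrite -poly_opB; apply: poly_op_bnd => //.
  move=> t /inab ht; have := hp n t ht; have := hp n.+1 t ht.
  rewrite exprS hornerD hornerN !ler_norml => /andP[? ?] /andP[? ?].
  have : 0 <= 2^-1 ^+ n :> R by rewrite exprn_ge0.
  by move=> ?; apply/andP; split; lra.
exists B => e e0.
(* The constant [4] is [2 / (1 - 2^-1)], from the sum of the geometric tail. *)
have [n hn] := geometric_small 4 half0 half1 e0.
have h0 : 0 <= 2^-1 ^+ n :> R by rewrite exprn_ge0.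
exists (p n) => [t /inab ht|].
  by apply: le_trans (hp n t ht) _; lra.
apply: bnd_le (hB n) _; apply: le_trans hn.
by rewrite le_eqVlt; apply/orP; left; apply/eqP; field.
Qed.

Lemma approx_qf f A B (c d : R) x : self_adjoint A -> approx f A B ->
  (forall t : R, spectrum A t%:C -> c <= f t <= d) ->
  c * nm x ^+ 2 <= qf B x <= d * nm x ^+ 2.
Proof.
move=> hA hB h; have hs := approx_sa hA hB; apply/andP; split.
  have /(le_opP (sa_scalar c) hs) /(_ x) : le_op (c%:C *: Id) B.
    by apply: approx_le (approx_cst c A) hB _ => // t /h /andP[].
  by rewrite !qfE.
have /(le_opP hs (sa_scalar d)) /(_ x) : le_op B (d%:C *: Id).
  by apply: approx_le hB (approx_cst d A) _ => // t /h /andP[].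
by rewrite !qfE.
Qed.

Lemma approx_spectrum_in f A B (c d : R) : self_adjoint A -> approx f A B ->
  (forall t : R, spectrum A t%:C -> c <= f t <= d) -> spectrum_in B `[c, d].
Proof.
move=> hA hB h; apply: sa_spectrum_in; first exact: approx_sa hB.
by move=> x; exact: approx_qf hB h.
Qed.

Lemma approx_horner p f A B (c d : R) : self_adjoint A -> approx f A B ->
  (forall t : R, spectrum A t%:C -> c <= f t <= d) ->
  approx (fun t => p.[f t]) A (poly_op p B).
Proof.
move=> hA hB h.
pose K := `|c| + `|d|.
have fK t : spectrum A t%:C -> `|f t| <= K.
  move=> /h /andP[? ?]; have := ler_norm d; have := ler_norm (- c).
  have := normr_ge0 c; have := normr_ge0 d.
  by rewrite normrN ler_norml /K => *; apply/andP; split; lra.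
(* [approxM] needs bounded factors, so the induction also carries a bound on [p] composed with
   [f]. *)
suff [] : approx (fun t => p.[f t]) A (poly_op p B) /\
  exists L : R, forall t : R, spectrum A t%:C -> `|p.[f t]| <= L by [].
elim/poly_ind: p => [|p k [ih [L hL]]].
  split; last by exists 0 => t _; rewrite horner0 normr0.
  have := approx_cst 0 A; rewrite -(poly_opC 0 B) polyC0 => /=.
  by apply: eq_approx => t _; rewrite horner0.
have hLK : forall t : R, spectrum A t%:C -> `|p.[f t]| <= `|L| + `|K|.
  by move=> t /hL /le_trans; apply; rewrite (le_trans (ler_norm _))// lerDl.
have hfK : forall t : R, spectrum A t%:C -> `|f t| <= `|L| + `|K|.
  by move=> t /fK /le_trans; apply; rewrite (le_trans (ler_norm _))// lerDr.
split; last first.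
  exists ((`|L| + `|K|) * (`|L| + `|K|) + `|k|) => t ht.
  rewrite hornerMXaddC; apply: le_trans (ler_normD _ _) _.
  by rewrite lerD2r normrM ler_pM ?hLK ?hfK.
rewrite poly_opD poly_opM poly_opX poly_opC.
have := approxD (approxM hA ih hB hLK hfK) (approx_cst k A).
by apply: eq_approx => t _; rewrite hornerMXaddC.
Qed.

(** With [q] close to [g] on the segment, [q(B)] is a function of [A] by [approx_horner]. It is
    close to [C] because any polynomial [r] defining [C] is close to [q] on the spectrum of [B]. *)
Lemma approx_comp g f A B C (c d : R) : self_adjoint A -> c < d ->
  approx f A B -> (forall t : R, spectrum A t%:C -> c <= f t <= d) ->
  {within `[c, d], continuous g} -> approx g B C ->
  approx (g \o f) A C.
Proof.
move=> hA cd hB h cg hC e e0.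
have hsB := approx_sa hA hB; have hspB := approx_spectrum_in hA hB h.
have e4 : 0 < e / 4 by rewrite divr_gt0.
have [q hq] := weierstrass cd e4 cg.
have [p hp hpB] := approx_horner q hA hB h e4.
exists p => [t ht|].
  have := hq (f t); rewrite in_itv /= => /(_ (h t ht)).
  have := hp t ht; rewrite !ler_norml => /andP[? ?] /andP[? ?].
  by apply/andP; split; lra.
have [r hr hrC] := hC _ e4.
have hqr : bnd (poly_op q B - poly_op r B) (e / 2).
  rewrite -poly_opB; apply: poly_op_bnd; rewrite ?divr_gt0// => t ht.
  have [s hs /complexI st] := hspB _ ht; rewrite st in hs.
  have := hq t hs; have := hr t ht; rewrite hornerD hornerN !ler_norml.
  by move=> /andP[? ?] /andP[? ?]; apply/andP; split; lra.
have -> : poly_op p A - C =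
   (poly_op p A - poly_op q B) + ((poly_op q B - poly_op r B) + (poly_op r B - C)).
  by rewrite !addrA !subrK.
by apply: bnd_le (bndD hpB (bndD hqr hrC)) _; lra.
Qed.

End FunctionalCalculus.

(** * Mercer means *)

Section RealLemmas.
Context {R : realType}.
Implicit Types (f g : R -> R).

Lemma within_continuous_o (D E : set R) f g :
  {within D, continuous f} -> {within E, continuous g} ->
  (forall x, D x -> E (f x)) -> {within D, continuous (g \o f)}.
Proof.
move=> /within_continuousP cf /within_continuousP cg DE.
apply/within_continuousP => x Dx e e0.
have [d d0 hd] := cg (f x) (DE x Dx) e e0.
have [r r0 hr] := cf x Dx d d0.
by exists r => // y Dy xy; apply: hd; [exact: DE|exact: hr].
Qed.

Lemma within_continuous_affine (D : set R) f (k l : R) :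
  {within D, continuous f} -> {within D, continuous (fun t => k * f t + l)}.
Proof.
move=> cf; apply: (within_continuous_o (E := setT) (g := fun t => k * t + l) cf) => //.
apply: continuous_subspaceT => t.
by apply: cvgD; [apply: cvgM; [exact: cvg_cst|exact: cvg_id]|exact: cvg_cst].
Qed.

Lemma strictly_monotonic_inj (D : set R) f :
  strictly_monotonic D f -> {in D &, injective f}.
Proof.
by move=> [h|h] x y Dx Dy fxy; case: (ltgtP x y) => // xy;
  [have := h _ _ Dx Dy xy|have := h _ _ Dy Dx xy
  |have := h _ _ Dx Dy xy|have := h _ _ Dy Dx xy]; rewrite fxy ltxx.
Qed.

Lemma strictly_monotonic_bounds (m M : R) f x : m < M ->
  strictly_monotonic `[m, M] f -> x \in `[m, M] ->
  Num.min (f m) (f M) <= f x <= Num.max (f m) (f M).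
Proof.
move=> mM hf; rewrite in_itv /= => /andP[mx xM].
have hin y : m <= y <= M -> y \in [set` `[m, M]] by rewrite mem_setE in_itv.
have hm : m \in [set` `[m, M]] by apply: hin; rewrite lexx ltW.
have hM : M \in [set` `[m, M]] by apply: hin; rewrite lexx ltW.
have hx : x \in [set` `[m, M]] by apply: hin; rewrite mx.
case: hf => h.
  have h1 : f m <= f x.
    by move: mx; rewrite le_eqVlt => /predU1P[->//|/(h _ _ hm hx)/ltW].
  have h2 : f x <= f M.
    by move: xM; rewrite le_eqVlt => /predU1P[->//|/(h _ _ hx hM)/ltW].
  by rewrite ge_min le_max h1 h2 orbT.
have h1 : f x <= f m.
  by move: mx; rewrite le_eqVlt => /predU1P[->//|/(h _ _ hm hx)/ltW].
have h2 : f M <= f x.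
  by move: xM; rewrite le_eqVlt => /predU1P[->//|/(h _ _ hx hM)/ltW].
by rewrite ge_min le_max h1 h2 orbT.
Qed.

Lemma strictly_monotonic_neq (m M : R) f : m < M ->
  strictly_monotonic `[m, M] f -> f m != f M.
Proof.
move=> mM hf; apply/eqP => fmM; have := strictly_monotonic_inj hf _ _ fmM.
rewrite !mem_setE !in_itv /= !lexx (ltW mM) => /(_ isT isT) mM'.
by rewrite mM' ltxx in mM.
Qed.

Lemma image_segment (m M : R) f : m < M ->
  {within `[m, M], continuous f} -> strictly_monotonic `[m, M] f ->
  f @` `[m, M] = [set` f @`[m, M]].
Proof.
move=> mM cf hf; apply/seteqP; split=> [_ [x /= hx <-]|y /=].
  by rewrite in_itv; exact: strictly_monotonic_bounds.
rewrite in_itv /= => /(IVT (ltW mM) cf)[x hx xy].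
by exists x.
Qed.

Lemma pinv_can (m M : R) f : strictly_monotonic `[m, M] f ->
  {in `[m, M], cancel f (pinv `[m, M] f)}.
Proof.
move=> hf x hx; apply: pinvKV; last by rewrite mem_setE.
exact: strictly_monotonic_inj.
Qed.

Lemma pinv_segment (m M : R) f t : m < M ->
  {within `[m, M], continuous f} -> strictly_monotonic `[m, M] f ->
  t \in f @`[m, M] -> pinv `[m, M] f t \in `[m, M] /\ f (pinv `[m, M] f t) = t.
Proof.
move=> mM cf hf ht; have : (f @` `[m, M]) t by rewrite image_segment.
by move=> [x /= hx <-]; rewrite (pinv_can hf).
Qed.

Lemma pinv_continuous (m M : R) f : m < M ->
  {within `[m, M], continuous f} -> strictly_monotonic `[m, M] f ->
  {within [set` f @`[m, M]], continuous pinv `[m, M] f}.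
Proof.
move=> mM cf hf; apply: segment_can_continuous (ltW mM) cf _ => x hx.
exact: (pinv_can hf).
Qed.

(** At logarithms, this is the inequality between weighted geometric and arithmetic means. *)
Lemma expR_mean_le (a b w : R) : 0 <= w <= 1 ->
  expR (w * a + (1 - w) * b) <= w * expR a + (1 - w) * expR b.
Proof. by move=> /andP[w0 w1]; exact: (convex_expR (Itv01 w0 w1) a b). Qed.

Lemma log_convex_le (D : set R) f (s t w : R) : log_convex D f ->
  D s -> D t -> 0 <= w <= 1 -> D (w * s + (1 - w) * t) ->
  f (w * s + (1 - w) * t) <= expR (w * ln (f s) + (1 - w) * ln (f t)).
Proof.
move=> [fpos fcvx] Ds Dt /andP[w0 w1] Dst.
have := fcvx (Itv01 w0 w1) s t; rewrite !inE => /(_ Ds Dt).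
rewrite !convRE /= => h.
by rewrite -[leLHS]lnK ?posrE ?fpos// ler_expR.
Qed.

End RealLemmas.

Section PositiveMaps.
Context {R : realType} {H K : hilbertType R}.

(** A self-adjoint [X] is the difference of the positive operators [X + N] and [N], and positive
    images are self-adjoint. *)
Lemma positive_map_sa (F : {linear 'B(H) -> 'B(K)}) X : positive_map F ->
  self_adjoint X -> self_adjoint (F X).
Proof.
move=> hF hX; have [N N0 hN] := bnd_ex X.
have h1 : positive_op (1 : 'B(H)).
  by apply/(positiveP sa1) => x; rewrite qf1 sqr_ge0.
have h2 : positive_op (X + N%:C *: (1 : 'B(H))).
  apply/positiveP; first by apply: saD => //; exact: sa_scalar.
  by move=> x; have := qf_bnd x hN; rewrite !qfE ler_norml => /andP[? _]; lra.
have -> : F X = F (X + N%:C *: (1 : 'B(H))) - N%:C *: F 1.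
  by rewrite linearD linearZ /= addrK.
by apply: saB; [|apply: saZ]; apply: positive_sa; exact: hF.
Qed.

Lemma positive_map_le (F : {linear 'B(H) -> 'B(K)}) X Y : positive_map F ->
  le_op X Y -> le_op (F X) (F Y).
Proof. by move=> hF /hF; rewrite linearB. Qed.

End PositiveMaps.

(** * Unital sums of positive maps *)

Section SumPhi.
Context {R : realType} {H K : hilbertType R} {n : nat}.
Context (m M : R) (A : 'I_n -> 'B(H)) (Phi : 'I_n -> {linear 'B(H) -> 'B(K)}).
Context (mM : m < M).
Context (A_pos : forall i, positive_op (A i)).
Context (A_sp : forall i, spectrum_in (A i) `[m, M]).
Context (Phi_pos : forall i, positive_map (Phi i)).
Context (Phi1 : \sum_(i < n) Phi i 1 = 1).
Implicit Types f g : R -> R.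

Let A_sa i : self_adjoint (A i). Proof. exact: positive_sa. Qed.

Let A_in i (t : R) : spectrum (A i) t%:C -> t \in `[m, M].
Proof. by move=> /A_sp [s hs /complexI <-]. Qed.

Let fun_calcA f i : {within `[m, M], continuous f} ->
  approx f (A i) (fun_calc f (A i)).
Proof.
move=> cf; have [B hB] := approx_exists (A_sa i) mM (@A_sp i) cf.
by rewrite (approx_fun_calc (A_sa i) hB).
Qed.

Lemma sum_Phi_sa f : {within `[m, M], continuous f} ->
  self_adjoint (sum_Phi A Phi f).
Proof.
move=> cf; apply: sa_sum => i _; apply: positive_map_sa => //.
exact: approx_sa (fun_calcA i cf).
Qed.

(** Unitality enters here: it sends the constant [l] to [l] times the identity. *)
Lemma sum_Phi_affine f (k l : R) : {within `[m, M], continuous f} ->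
  sum_Phi A Phi (fun t => k * f t + l) =
  k%:C *: sum_Phi A Phi f + l%:C *: (1 : 'B(K)).
Proof.
move=> cf; rewrite -Phi1 !scaler_sumr -big_split /=; apply: eq_bigr => i _.
rewrite -!linearZ -linearD; congr (Phi i _); apply: approx_fun_calc => //.
exact: approxD (approxZ k (fun_calcA i cf)) (approx_cst l (A i)).
Qed.

Lemma sum_Phi_le f g x : {within `[m, M], continuous f} ->
  {within `[m, M], continuous g} -> (forall t, t \in `[m, M] -> f t <= g t) ->
  qf (sum_Phi A Phi f) x <= qf (sum_Phi A Phi g) x.
Proof.
move=> cf cg fg; apply: (le_opP (sum_Phi_sa cf) (sum_Phi_sa cg)).1.
rewrite /le_op /sum_Phi -sumrB; elim/big_ind : _ => [y|X Y hX hY y|i _].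
- by rewrite op0 linear0l.
- by rewrite opD linearDl; apply: addr_ge0; [exact: hX|exact: hY].
- apply: positive_map_le => //.
  by apply: approx_le (A_sa i) (fun_calcA i cf) (fun_calcA i cg) _ => t /A_in /fg.
Qed.

Lemma sum_Phi_qf f (c d : R) x : {within `[m, M], continuous f} ->
  (forall t, t \in `[m, M] -> c <= f t <= d) ->
  c * nm x ^+ 2 <= qf (sum_Phi A Phi f) x <= d * nm x ^+ 2.
Proof.
move=> cf hf.
(* The constant bounds are written as affine functions of [f] with slope [0], so that
   [sum_Phi_affine] evaluates them. *)
have sc (e : R) : qf (sum_Phi A Phi (fun t => 0 * f t + e)) x = e * nm x ^+ 2.
  by rewrite sum_Phi_affine// !qfE mul0r add0r.
have cc (e : R) := @within_continuous_affine _ _ f 0 e cf.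
rewrite -!sc; apply/andP; split; apply: sum_Phi_le => // t ht;
  by rewrite mul0r add0r; have /andP[] := hf t ht.
Qed.

End SumPhi.

(** Presents a power with an affine exponent in [T] as a function of [T], so that the two powers in
    the theorem can be multiplied by [approxM]. *)
Lemma approx_pow_op (R : realType) (H : hilbertType R) (T : 'B(H)) (a b c k l : R) :
  self_adjoint T -> spectrum_in T `[a, b] ->
  (forall t : R, t \in `[a, b] -> 0 <= k * t + l <= 1) ->
  approx (fun t => expR (ln c * (k * t + l))) T
    (pow_op c (k%:C *: T + l%:C *: (1 : 'B(H)))).
Proof.
(* The exponent lies in [[0, 1]], so its product with [ln c] stays in [[- L, L]]; the [1] in [L]
   keeps this segment nondegenerate when [c] is [1]. *)
move=> hT hsp h; pose L := `|ln c| + 1.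
pose E := (ln c)%:C *: (k%:C *: T + l%:C *: (1 : 'B(H))).
have hE : approx (fun t => ln c * (k * t + l)) T E.
  apply: approxZ; apply: approxD (approx_cst l T); apply: approxZ.
  have := approx_poly 'X T; rewrite poly_opX.
  by apply: eq_approx => t _; rewrite hornerX.
have hLL : - L < L by rewrite /L; have := normr_ge0 (ln c); lra.
have hl (t : R) : spectrum T t%:C -> - L <= ln c * (k * t + l) <= L.
  move=> /hsp [s /h + /complexI <-] => /andP[? ?].
  have := ler_norm (ln c); have := ler_norm (- ln c); rewrite normrN /L => ? ?.
  by apply/andP; split; nra.
have cexp : {within `[- L, L], continuous (@expR R)}.
  by apply: continuous_subspaceT => x; exact: continuous_expR.
have hsE := approx_sa hT hE.
have [X hX] := approx_exists hsE hLL (approx_spectrum_in hT hE hl) cexp.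
have := approx_comp hT hLL hE hl cexp hX.
by rewrite /pow_op -/E (approx_fun_calc hsE hX).
Qed.

Lemma scalar_affine (R : realType) (H : hilbertType R) (S : 'B(H)) (k c l : R) :
  k%:C *: (c%:C *: (1 : 'B(H)) - S) + l%:C *: (1 : 'B(H)) =
  (- k)%:C *: S + (k * c + l)%:C *: (1 : 'B(H)).
Proof.
rewrite scalerBr scalerA -rmorphM rmorphN scaleNr rmorphD scalerDl.
by rewrite addrAC [LHS]addrC.
Qed.

Theorem theorem3p3 (R : realType) (H K : hilbertType R) (m M : R) (n : nat)
    (A : 'I_n -> 'B(H)) (Phi : 'I_n -> {linear 'B(H) -> 'B(K)})
    (phi psi : R -> R) :
  0 < m -> m < M ->
  (forall i, positive_op (A i)) ->
  (forall i, invertible_op (A i)) ->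
  (forall i, spectrum_in (A i) `[m, M]) ->
  (forall i, positive_map (Phi i)) ->
  \sum_(i < n) Phi i 1 = 1 ->
  {within `[m, M], continuous phi} ->
  {within `[m, M], continuous psi} ->
  strictly_monotonic `[m, M] phi ->
  strictly_monotonic `[m, M] psi ->
  log_convex (phi @` `[m, M]) (psi \o pinv `[m, M] phi) ->
  operator_increasing (psi @` `[m, M]) (pinv `[m, M] psi) ->
  let S := sum_Phi A Phi phi in
  let d := phi M - phi m in
  let middle := fun_calc (pinv `[m, M] psi)
    (pow_op (psi m) (d^-1%:C *: (S - (phi m)%:C *: (1 : 'B(K)))) *
     pow_op (psi M) (d^-1%:C *: ((phi M)%:C *: (1 : 'B(K)) - S))) in
  le_op (mercer_mean m M A Phi phi) middle /\
  le_op middle (mercer_mean m M A Phi psi).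
Proof.
move=> _ mM Apos _ Asp Phipos Phi1 cphi cpsi hphi hpsi lcvx opinc S d middle.
have hin y : m <= y <= M -> y \in `[m, M] by rewrite in_itv.
have hm : m \in `[m, M] by apply: hin; rewrite lexx ltW.
have hM : M \in `[m, M] by apply: hin; rewrite lexx ltW.
have d0 : d != 0.
  by rewrite subr_eq0 eq_sym; exact: strictly_monotonic_neq hphi.
have phimE : phi m = phi M - d by rewrite /d; ring.
(* Either function may be decreasing, so the endpoints of the images are put in order. *)
set a := Num.min (phi m) (phi M); set b := Num.max (phi m) (phi M).
set r := Num.min (psi m) (psi M); set s := Num.max (psi m) (psi M).
have lt_minmax (f : R -> R) : strictly_monotonic `[m, M] f ->
    Num.min (f m) (f M) < Num.max (f m) (f M).
  move=> /(strictly_monotonic_neq mM); case: (ltgtP (f m) (f M)) => //.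
have ab : a < b by exact: lt_minmax.
have rs : r < s by exact: lt_minmax.
have addminmax (x y : R) : Num.min x y + Num.max x y = x + y.
  by rewrite addr_min_max.
have psi_pos x : x \in `[m, M] -> 0 < psi x.
  move=> hx; have := lcvx.1 (phi x); rewrite /= (pinv_can hphi)//; apply.
  by exists x.
have hpsim := psi_pos m hm; have hpsiM := psi_pos M hM.
have sum_bounds f x : {within `[m, M], continuous f} ->
    strictly_monotonic `[m, M] f ->
    Num.min (f m) (f M) * nm x ^+ 2 <= qf (sum_Phi A Phi f) x
      <= Num.max (f m) (f M) * nm x ^+ 2.
  move=> cf hf; apply: (sum_Phi_qf mM Apos Asp Phipos Phi1) => // t.
  exact: strictly_monotonic_bounds.
pose T : 'B(K) := (phi M + phi m)%:C *: (1 : 'B(K)) - S.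
have hS : self_adjoint S by exact: sum_Phi_sa cphi.
have hT : self_adjoint T by apply: saB => //; exact: sa_scalar.
(* [T] is the reflection of [S] in the midpoint of [[a, b]], as [a + b] is [phi m + phi M]. *)
have Tsp : spectrum_in T `[a, b].
  apply: sa_spectrum_in => // x; have := sum_bounds phi x cphi hphi.
  have := addminmax (phi m) (phi M); rewrite -/a -/b -/S !qfE => h /andP[? ?].
  by apply/andP; split; nra.
have Tin (t : R) : spectrum T t%:C -> t \in `[a, b].
  by move=> /Tsp [u hu /complexI <-].
pose w t := d^-1 * (phi M - t).
have w01 t : t \in `[a, b] -> 0 <= w t <= 1.
  rewrite in_itv /= /w /a /b; case: (ltgtP (phi m) (phi M)) => [lt|gt|eq].
  - move=> /andP[h1 h2]; have dp : 0 < d by rewrite subr_gt0.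
    rewrite mulr_ge0 ?invr_ge0 ?(ltW dp) ?subr_ge0//=.
    by rewrite ler_pdivrMl// mulr1 lerB.
  - move=> /andP[h1 h2]; have dp : 0 < - d by rewrite oppr_gt0 subr_lt0.
    have -> : d^-1 * (phi M - t) = (- d)^-1 * (t - phi M).
      by rewrite invrN mulNr -mulrN opprB.
    rewrite mulr_ge0 ?invr_ge0 ?(ltW dp) ?subr_ge0//=.
    by rewrite ler_pdivrMl// mulr1 opprB lerB.
  - by move: d0; rewrite /d eq subrr eqxx.
have wE t : t = w t * phi m + (1 - w t) * phi M.
  by rewrite /w phimE; field.
pose g := psi \o pinv `[m, M] phi.
have phib x : x \in `[m, M] -> phi x \in `[a, b].
  by move=> hx; rewrite in_itv; exact: strictly_monotonic_bounds.
have g_rs t : t \in `[a, b] -> r <= g t <= s.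
  move=> /(pinv_segment mM cphi hphi)[h _].
  exact: strictly_monotonic_bounds.
have cg : {within `[a, b], continuous g}.
  apply: within_continuous_o (pinv_continuous mM cphi hphi) cpsi _.
  by move=> t /= /(pinv_segment mM cphi hphi)[].
(* The middle product is [h(T)]: [w(T)] is the exponent of [psi m], since [phi M - T] equals
   [S - phi m], and [1 - w(T)] is that of [psi M]. *)
pose h t := expR (ln (psi m) * w t) * expR (ln (psi M) * (1 - w t)).
have g_h t : t \in `[a, b] -> g t <= h t.
  move=> ht; have imt : (phi @` `[m, M]) t by rewrite image_segment.
  have := log_convex_le (s := phi m) (t := phi M) (w := w t) lcvx _ _ (w01 t ht).
  rewrite -wE /= !(pinv_can hphi)// => /(_ _ _ imt).
  rewrite /h -expRD [w t * _]mulrC [(1 - w t) * _]mulrC; apply.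
    by exists m.
  by exists M.
have h_chord t : t \in `[a, b] -> h t <= w t * psi m + (1 - w t) * psi M.
  move=> ht; have := expR_mean_le (ln (psi m)) (ln (psi M)) (w01 t ht).
  by rewrite !lnK ?posrE// expRD /h [w t * ln _]mulrC [(1 - w t) * ln _]mulrC.
have chord_le t : t \in `[a, b] -> w t * psi m + (1 - w t) * psi M <= s.
  move=> /w01/andP[w0 w1].
  have h1 : psi m <= s by rewrite /s le_max lexx.
  have h2 : psi M <= s by rewrite /s le_max lexx orbT.
  by nra.
(* Places the spectrum of the product in the domain of the inverse of [psi]; the lower bound comes
   from [g], the upper one from the chord. *)
have h_rs t : t \in `[a, b] -> r <= h t <= s.
  move=> ht; have /andP[? ?] := g_rs t ht.
  apply/andP; split; first by apply: le_trans (g_h t ht).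
  exact: le_trans (h_chord t ht) (chord_le t ht).
have [G hG] := approx_exists hT ab Tsp cg.
have hGsa := approx_sa hT hG.
have TG t : spectrum T t%:C -> r <= g t <= s by move=> /Tin/g_rs.
have Gsp := approx_spectrum_in hT hG TG.
have cpinv := pinv_continuous mM cpsi hpsi.
have [Z hZ] := approx_exists hGsa rs Gsp cpinv.
(* The inverse of [phi] at [T] becomes the inverse of [psi] at [G = g(T)], the form to which
   operator monotonicity applies. *)
have mercer_phi : mercer_mean m M A Phi phi = fun_calc (pinv `[m, M] psi) G.
  rewrite (approx_fun_calc hGsa hZ); apply: approx_fun_calc => //.
  apply: eq_approx (approx_comp hT rs hG TG cpinv hZ) => t /Tin ht /=.
  by rewrite /g /= (pinv_can hpsi)//; have [] := pinv_segment mM cphi hphi ht.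
set P1 := pow_op (psi m) _ in middle *; set P2 := pow_op (psi M) _ in middle *.
have hP1 : approx (fun t => expR (ln (psi m) * w t)) T P1.
  have := @approx_pow_op _ _ T a b (psi m) (- d^-1) (d^-1 * phi M) hT Tsp.
  have kE t : - d^-1 * t + d^-1 * phi M = w t by rewrite /w; ring.
  have -> : (- d^-1)%:C *: T + (d^-1 * phi M)%:C *: (1 : 'B(K)) =
      d^-1%:C *: (S - (phi m)%:C *: (1 : 'B(K))).
    rewrite scalar_affine scalerBr scalerA -rmorphM -scaleNr -rmorphN /= opprK.
    by congr (_ + _%:C *: _); ring.
  by move=> hp; apply: eq_approx (hp _) => [t _|t /w01]; rewrite kE.
have hP2 : approx (fun t => expR (ln (psi M) * (1 - w t))) T P2.
  have := @approx_pow_op _ _ T a b (psi M) d^-1 (- (d^-1 * phi m)) hT Tsp.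
  have kE t : d^-1 * t - d^-1 * phi m = 1 - w t.
    by rewrite /w phimE; field.
  have -> : d^-1%:C *: T + (- (d^-1 * phi m))%:C *: (1 : 'B(K)) =
      d^-1%:C *: ((phi M)%:C *: (1 : 'B(K)) - S).
    rewrite scalar_affine scalerBr scalerA -rmorphM addrC -scaleNr -rmorphN /=.
    by congr (_%:C *: _ + _); ring.
  move=> hp; apply: eq_approx (hp _) => [t _|t /w01/andP[h1 h2]].
    by rewrite kE.
  by rewrite kE subr_ge0 h2 gerBl h1.
have hP : approx h T (P1 * P2).
  pose L := expR (`|ln (psi m)| + `|ln (psi M)|).
  apply: (approxM (K := L) hT hP1 hP2) => t /Tin/w01/andP[? ?].
    rewrite (ger0_norm (expR_ge0 _)) ler_expR.
    have := ler_norm (ln (psi m)); have := normr_ge0 (ln (psi m)).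
    by have := normr_ge0 (ln (psi M)); nra.
  rewrite (ger0_norm (expR_ge0 _)) ler_expR.
  have := ler_norm (ln (psi M)); have := normr_ge0 (ln (psi m)).
  by have := normr_ge0 (ln (psi M)); nra.
have Th t : spectrum T t%:C -> r <= h t <= s by move=> /Tin/h_rs.
have hPsa := approx_sa hT hP; have Psp := approx_spectrum_in hT hP Th.
have psi_im : psi @` `[m, M] = [set` `[r, s]] by exact: image_segment.
rewrite psi_im in opinc; split.
  rewrite mercer_phi; apply: (opinc K G (P1 * P2) hGsa hPsa Gsp Psp).
  by apply: (approx_le hT hG hP) => t /Tin/g_h.
pose W := (psi M + psi m)%:C *: (1 : 'B(K)) - sum_Phi A Phi psi.
have hWsa : self_adjoint W.
  exact: saB (sa_scalar _) (sum_Phi_sa mM Apos Asp Phipos cpsi).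
have Wsp : spectrum_in W `[r, s].
  apply: (sa_spectrum_in hWsa) => x; have := sum_bounds psi x cpsi hpsi.
  have := addminmax (psi m) (psi M); rewrite -/r -/s !qfE => e /andP[? ?].
  by apply/andP; split; nra.
apply: (opinc K (P1 * P2) W hPsa hWsa Psp Wsp).
(* Slope and intercept of the chord [w t * psi m + (1 - w t) * psi M]. *)
pose k := - (d^-1 * (psi m - psi M)).
pose l := psi M + d^-1 * phi M * (psi m - psi M).
have chordE t : w t * psi m + (1 - w t) * psi M = k * t + l.
  by rewrite /w /k /l; ring.
have hT1 : approx id T T.
  have := approx_poly 'X T; rewrite poly_opX.
  by apply: eq_approx => t _; rewrite hornerX.
have hY : approx (fun t => k * t + l) T (k%:C *: T + l%:C *: (1 : 'B(K))).
  exact: approxD (approxZ k hT1) (approx_cst l T).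
apply/(le_opP hPsa hWsa) => x.
have h1 : qf (P1 * P2) x <= qf (k%:C *: T + l%:C *: (1 : 'B(K))) x.
  apply: (le_opP hPsa (approx_sa hT hY)).1.
  by apply: approx_le hT hP hY _ => t /Tin ht; rewrite -chordE h_chord.
(* On [[m, M]], [psi] is [g] composed with [phi], hence below the chord at [phi]; the positive maps
   preserve this bound. *)
have h2 : qf (sum_Phi A Phi psi) x <= qf (k%:C *: S + l%:C *: (1 : 'B(K))) x.
  rewrite /S -(sum_Phi_affine mM Apos Asp Phi1 k l cphi).
  have ckl := @within_continuous_affine _ _ phi k l cphi.
  apply: (sum_Phi_le mM Apos Asp Phipos x cpsi ckl) => t ht; rewrite -chordE.
  apply: le_trans (h_chord _ (phib t ht)); apply: le_trans (g_h _ (phib t ht)).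
  by rewrite /g /= (pinv_can hphi).
apply: le_trans h1 _; move: h2; rewrite !qfE.
(* The chord takes the values [psi m] and [psi M] at [phi m] and [phi M]. Therefore [k * T + l] and
   [k * S + l] add up to [psi m + psi M], and [h1] and [h2] combine. *)
have e1 : k * (phi m + phi M) + 2 * l = psi m + psi M.
  by rewrite /k /l phimE; field.
by nra.
Qed.
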